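(* Let $X$ be a compact metric space, $T:X\to X$ a homeomorphism, $\mu$ a $T$-ergodic Borel probability measure on $X$ with $\operatorname{supp}\mu=X$, and $f\in C(X,\mathbb{R})$. Let $\nu$ be a compactly supported Borel probability measure on $\mathbb{R}$ whose topological support $S=\operatorname{supp}\nu$ satisfies $\#S\ge 2$. Let $\Sigma_1$ be the $\mu\times\nu^{\mathbb{Z}}$-almost sure spectrum of the operators $H_x+W_\omega$ (as defined in the context). If $X$ is connected, then $\Sigma_1$ is a finite union of non-degenerate compact intervals.
   Context: For $x\in X$ put $V_x(n)=f(T^nx)$, $n\in\mathbb{Z}$, and let $H_x$ be the bounded self-adjoint operator in $\ell^2(\mathbb{Z})$ given by $[H_x\psi](n)=\psi(n+1)+\psi(n-1)+V_x(n)\psi(n)$. Let $\Omega=S^{\mathbb{Z}}$, $\tilde\mu=\nu^{\mathbb{Z}}$, and for $\omega\in\Omega$ let $W_\omega$ be the multiplication operator by the potential $W_\omega(n)=\omega_n$, $n\in\mathbb{Z}$. The measure $\mu\times\tilde\mu$ is ergodic with respect to the product of $T$ and the left shift, and by general theory there is a compact set $\Sigma_1\subset\mathbb{R}$ with $\sigma(H_x+W_\omega)=\Sigma_1$ for $\mu\times\tilde\mu$-almost every $(x,\omega)\in X\times\Omega$. A compact interval $[a,b]$ is non-degenerate if $a<b$. *)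

(* Defs.v *)
From HB Require Import structures.
From mathcomp Require Import all_boot all_order all_algebra.
From mathcomp Require Import all_classical all_reals all_analysis.
From mathcomp Require Import complex.

Set Implicit Arguments.
Unset Strict Implicit.
Unset Printing Implicit Defensive.

Import Order.TTheory GRing.Theory Num.Theory.
Import numFieldNormedType.Exports.

Local Open Scope classical_set_scope.
Local Open Scope ring_scope.

(* The library's measurable types are pointed; a space carrying a probability
   measure is nonempty anyway. *)
#[short(type="pmetricType")]
HB.structure Definition PointedMetric (K : numDomainType) :=
  { M of Pointed M & Metric K M }.

Definition borel (X : ptopologicalType) := g_sigma_algebraType (@open X).

Record homeomorphism (X : topologicalType) := Homeomorphism {
  homeo :> X -> X;
  homeo_inv : X -> X;
  homeoK : cancel homeo homeo_inv;
  homeo_invK : cancel homeo_inv homeo;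
  homeo_continuous : continuous homeo;
  homeo_inv_continuous : continuous homeo_inv }.

Definition homeo_iter (X : topologicalType) (T : homeomorphism X) (n : int) :
    X -> X :=
  match n with
  | Posz k => iter k T
  | Negz k => iter k.+1 (homeo_inv T)
  end.

Definition measure_support (R : realType) (X : topologicalType)
    (mu : set X -> \bar R) : set X :=
  [set x | forall U, open U -> U x -> (0 < mu U)%E].

Definition ergodic d (Y : measurableType d) (R : realType)
    (mu : probability Y R) (T : Y -> Y) : Prop :=
  (forall A, measurable A -> mu (T @^-1` A) = mu A) /\
  (forall A, measurable A -> T @^-1` A = A -> mu A = 0%E \/ mu A = 1%E).

Lemma measure_support_neq0 (R : realType) (nu : probability R R) :
  measure_support (nu : set R -> \bar R) !=set0.
Proof.
apply/set0P/eqP => supp0.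
have nullb (x : R) : exists U, [/\ open U, U x & nu U = 0%E].
  have : ~ measure_support (nu : set R -> \bar R) x by rewrite supp0.
  move=> /existsNP[U] /not_implyP[oU] /not_implyP[Ux] /negP.
  by rewrite -leNgt => nuU; exists U; split => //; apply/eqP; rewrite -measure_le0.
have /choice[U UP] := nullb.
suff : nu.-negligible [set: R].
  move=> /(negligibleP nu measurableT) nu0.
  have := @probability_setT _ _ _ nu; rewrite nu0 => /esym/eqP.
  by rewrite onee_eq0.
rewrite -(@bigcup_itvT R true false); apply: negligible_bigcup => n.
have /= := @segment_compact R (1 *- n) n%:R.
rewrite compact_cover => /(_ R [set: R] U).
case=> [i _|x _|D _ cvD]; first by case: (UP i).
  by exists x => //; case: (UP x).
apply: negligibleS cvD _.
rewrite /cover bigcup_fset.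
rewrite big_seq; elim/big_ind : _ => [|A B nA nB|i _].
- exact: negligible_set0.
- exact: negligibleU.
- case: (UP i) => oU _ nuU; exists (U i); split => //.
  exact: measurable_realfun.open_measurable.
Qed.

(* S = supp nu as a type. *)
Definition support_type (R : realType) (nu : probability R R) : Type :=
  set_type (measure_support (nu : set R -> \bar R)).

HB.instance Definition _ (R : realType) (nu : probability R R) :=
  Choice.on (support_type nu).
HB.instance Definition _ (R : realType) (nu : probability R R) :=
  isPointed.Build (support_type nu)
    (SigSub (mem_set (projT2 (cid (measure_support_neq0 nu))))).

Definition support_val (R : realType) (nu : probability R R)
  (s : support_type nu) : R := set_val s.

Definition coordinate_sets (R : realType) (nu : probability R R) :
    set (set (int -> support_type nu)) :=
  [set C | exists (n : int) (A : set R), measurable A /\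
     C = [set w | A (support_val (w n))]].

(* Omega = S^Z with the product sigma-algebra. *)
Definition sequence_space (R : realType) (nu : probability R R) :=
  g_sigma_algebraType (@coordinate_sets R nu).

(* P is the product measure nu^Z, which these values on finite-dimensional
   rectangles determine. *)
Definition is_product_measure (R : realType) (nu : probability R R)
    (P : probability (sequence_space nu) R) : Prop :=
  forall (F : seq int) (A : int -> set R), uniq F ->
    (forall n, measurable (A n)) ->
    P [set w | forall n, n \in F -> A n (support_val (w n))] =
    (\prod_(n <- F) nu (A n))%E.

Definition ell2_sqnorm (R : realType) (u : int -> R[i]) : \bar R :=
  \esum_(n in [set: int]) (Normc.normc (u n) ^+ 2)%:E.

Definition ell2 (R : realType) : set (int -> R[i]) :=
  [set u | (ell2_sqnorm u < +oo)%E].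

Definition ell2_norm (R : realType) (u : int -> R[i]) : R :=
  Num.sqrt (fine (ell2_sqnorm u)).

(* Operators in ell^2(Z) are represented by maps on all of C^Z, of which only
   the restriction to ell^2(Z) is relevant. *)
Definition bounded_operator (R : realType)
    (A : (int -> R[i]) -> (int -> R[i])) : Prop :=
  [/\ forall u, ell2 u -> ell2 (A u),
      forall (c : R[i]) u v, ell2 u -> ell2 v -> A (c *: u + v) = c *: A u + A v
    & exists M : R, forall u, ell2 u -> ell2_norm (A u) <= M * ell2_norm u].

Definition resolvent_set (R : realType)
    (A : (int -> R[i]) -> (int -> R[i])) : set R[i] :=
  [set z | exists B : (int -> R[i]) -> (int -> R[i]), bounded_operator B /\
     forall u, ell2 u -> A (B u) - z *: B u = u /\ B (A u - z *: u) = u].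

Definition spectrum (R : realType)
    (A : (int -> R[i]) -> (int -> R[i])) : set R[i] := ~` resolvent_set A.

Definition schroedinger (R : realType) (X : topologicalType)
    (T : homeomorphism X) (f : X -> R) (x : X)
    (psi : int -> R[i]) : int -> R[i] :=
  fun n => psi (n + 1) + psi (n - 1) + (f (homeo_iter T n x))%:C%C * psi n.

Definition random_potential (R : realType) (nu : probability R R)
    (w : sequence_space nu) (psi : int -> R[i]) : int -> R[i] :=
  fun n => (support_val (w n))%:C%C * psi n.

Definition almost_sure_spectrum (R : realType) (X : pmetricType R)
    (T : homeomorphism X) (mu : probability (borel X) R) (f : X -> R)
    (nu : probability R R) (P : probability (sequence_space nu) R)
    (Sigma : set R) : Prop :=
  compact Sigma /\
  {ae (mu \x P)%E, forall xw : borel X * sequence_space nu,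
     spectrum (schroedinger T f xw.1 + random_potential xw.2) =
     [set (E%:C)%C | E in Sigma]}.

(* Main.v *)
Require Import Defs.
From HB Require Import structures.
From mathcomp Require Import all_boot all_order all_algebra.
From mathcomp Require Import all_classical all_reals all_analysis.
From mathcomp Require Import complex ring lra zify.

Set Implicit Arguments.
Unset Strict Implicit.
Unset Printing Implicit Defensive.

Import Order.TTheory GRing.Theory Num.Theory.
Import numFieldNormedType.Exports.

Local Open Scope classical_set_scope.
Local Open Scope ring_scope.

(** Write V_x(n) = f(T^n x), let S be the support of nu, p < q its extreme
    points, and call e an approximate eigenvalue when the operators H_x - e
    are not bounded below uniformly in x; let Sigma0 be the set of these e,
    and m < M its extreme points.  The almost sure spectrum Sigma1 is compact,
    so it suffices to put every point of it in a segment contained in Sigma1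
    whose length is at least a fixed d > 0
    ([finite_union_of_segments]); here d = min (q - p, M - m).

    Reduction to bounds from below.  A Jacobi operator H with bounded real
    potential has E in its resolvent set exactly when |(H - E) psi| >= c |psi|
    for some c > 0 and all finitely supported psi
    ([bounded_below_of_resolvent_set] and [resolvent_set_of_bounded_below];
    the inverse is a Neumann series), and the best c is at least the distance
    to the spectrum ([bounded_below_distance]).  If E is not in Sigma1 the
    typical operators thus share one constant c.  Every finite pattern of a
    potential V_x + w, with x in X and w in S^Z, is approximated by typical
    ones, because mu x nu^Z charges all open boxes ([product_support]); so a
    bound of this kind holds for all x and all w ([off_spectrum]).

    Easy inclusions.  If E is in Sigma1, then E - q <= sigma <= E - p for some
    sigma in Sigma0 ([bounded_below_add]), and m <= E - s <= M for some s in S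
    ([bounded_below_outside]).

    Key fact ([spectral_dichotomy]).  Let E be outside Sigma1 and s < t in S.
    Then either no point of Sigma0 lies between E - t and E - s, or all of
    them do.  To see this, start from w = s, and replace s by t at the sites
    1, 2, 3, ... in turn.  All intermediate operators are invertible.  The
    change at one site i is a rank one perturbation ([rank_one]), and an
    eigenvalue of the path crosses zero exactly when 1 + (t - s) G(i, i) is
    negative, G being the Green function before the change.  This number never
    vanishes and is continuous in x, so its sign does not depend on x, X being
    connected ([coupling_sign]).  After translating the site i to 1, the
    configuration converges to t on the left half-line, s on the right one, so
    the sign is the same for all large i ([coupling_sign_eventually]).  On the
    other hand, open sets recur under T, so each sigma in Sigma0 provides,
    along one orbit, as many disjoint approximate eigenvectors as desired.  A
    combination of these which does not see the first few sites ([packets])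
    compares 1 / (sigma - E + s) with 1 / (sigma - E + t), in a direction
    dictated by the sign ([approx_eigenvalue_sign]).

    Conclusion ([spectrum_segments]).  Let q - p < M - m and sigma in Sigma0.
    For E in sigma + [p, q] outside Sigma1, the point sigma lies between E - q
    and E - p, hence so does Sigma0, although its diameter M - m is larger.
    Let q - p >= M - m and s in S.  For E in s + [m, M] outside Sigma1, the
    point E - s separates m from M, so that Sigma0 has no point between E - q
    and E - p; but then M - m > q - p.  So all these segments lie in Sigma1,
    and by the easy inclusions they cover it. *)

(** * Finitely supported sequences *)

Section finitely_supported.
Context {R : realType}.
Implicit Types (u v w p q : int -> R) (k c : R).

Definition finitary u := exists s : seq int, forall n, n \notin s -> u n = 0.

(** A big sum with infinitely many nonzero terms is 0, so this is the usual
    pairing as soon as one of the two arguments is finitary. *)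
Definition dot u w : R := \sum_(n \in [set: int]) u n * w n.

Lemma dotE (s : seq int) u w : uniq s -> (forall n, n \notin s -> u n * w n = 0) ->
  dot u w = \sum_(n <- s) u n * w n.
Proof.
move=> us h; rewrite /dot (fsbigE s)//=; last by move=> i _; exact: h.
by apply: eq_bigl => i; rewrite in_setT.
Qed.

Lemma finitary_uniq u : finitary u ->
  exists2 s : seq int, uniq s & forall n, n \notin s -> u n = 0.
Proof.
by case=> s h; exists (undup s); rewrite ?undup_uniq// => n; rewrite mem_undup; apply: h.
Qed.

Lemma finitary_uniq2 u w : finitary u -> finitary w -> exists2 s : seq int, uniq s &
  (forall n, n \notin s -> u n = 0) /\ (forall n, n \notin s -> w n = 0).
Proof.
case=> s h [t g]; exists (undup (s ++ t)); first exact: undup_uniq.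
by split=> n; rewrite mem_undup mem_cat negb_or => /andP[? ?]; [exact: h|exact: g].
Qed.

Lemma finitary0 : finitary 0. Proof. by exists [::]. Qed.

Lemma finitaryD u w : finitary u -> finitary w -> finitary (u + w).
Proof.
move=> fu fw; have [s _ [hu hw]] := finitary_uniq2 fu fw.
by exists s => n ns; rewrite fctE hu ?hw ?addr0.
Qed.

Lemma finitaryZ c u : finitary u -> finitary (c *: u).
Proof. by case=> s h; exists s => n ns; rewrite fctE h ?scaler0. Qed.

Lemma finitaryN u : finitary u -> finitary (- u).
Proof. by case=> s h; exists s => n ns; rewrite fctE h ?oppr0. Qed.

Lemma finitaryB u w : finitary u -> finitary w -> finitary (u - w).
Proof. by move=> fu fw; apply: finitaryD => //; exact: finitaryN. Qed.

Lemma finitary_sum (I : Type) (s : seq I) (F : I -> int -> R) :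
  (forall i, finitary (F i)) -> finitary (\sum_(i <- s) F i).
Proof. by move=> h; elim/big_ind : _ => //; [exact: finitary0|exact: finitaryD]. Qed.

Lemma finitaryM u v : finitary u -> finitary (fun n => v n * u n).
Proof. by case=> s h; exists s => n ns; rewrite h ?mulr0. Qed.

#[local] Hint Resolve finitary0 finitaryD finitaryZ finitaryN finitaryM : core.

Definition translate (j : int) u : int -> R := fun n => u (n + j).

Lemma finitary_translate j u : finitary u -> finitary (translate j u).
Proof.
case=> s h; exists [seq n - j | n <- s] => n ns; apply: h.
by apply: contra ns => ns; apply/mapP; exists (n + j); rewrite ?addrK.
Qed.

#[local] Hint Resolve finitary_translate : core.

Definition delta (i : int) : int -> R := fun n => (n == i)%:R.

Lemma finitary_delta i : finitary (delta i).
Proof. by exists [:: i] => n; rewrite inE /delta => /negbTE ->. Qed.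

Lemma dotC u w : dot u w = dot w u.
Proof. by apply: eq_fsbigr => n _; rewrite mulrC. Qed.

Lemma dotDl u u' w : finitary u -> finitary u' -> dot (u + u') w = dot u w + dot u' w.
Proof.
move=> fu fu'; have [s us [hu hw]] := finitary_uniq2 fu fu'.
rewrite !(@dotE s)//.
- by rewrite -big_split; apply: eq_bigr => i _; rewrite fctE mulrDl.
- by move=> n ns; rewrite hw ?mul0r.
- by move=> n ns; rewrite hu ?mul0r.
- by move=> n ns; rewrite fctE hu// hw// addr0 mul0r.
Qed.

Lemma dotZl c u w : dot (c *: u) w = c * dot u w.
Proof.
by rewrite /dot mulr_fsumr; apply: eq_fsbigr => n _; rewrite fctE mulrA.
Qed.

Lemma dotNl u w : dot (- u) w = - dot u w.
Proof. by rewrite -scaleN1r dotZl mulN1r. Qed.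

Lemma dotBl u u' w : finitary u -> finitary u' -> dot (u - u') w = dot u w - dot u' w.
Proof. by move=> fu fu'; rewrite dotDl ?dotNl//; exact: finitaryN. Qed.

Lemma dotDr u w w' : finitary w -> finitary w' -> dot u (w + w') = dot u w + dot u w'.
Proof. by move=> *; rewrite dotC dotDl// ![dot u _]dotC. Qed.

Lemma dotZr c u w : dot u (c *: w) = c * dot u w.
Proof. by rewrite dotC dotZl dotC. Qed.

Lemma dotNr u w : dot u (- w) = - dot u w.
Proof. by rewrite dotC dotNl dotC. Qed.

Lemma dotBr u w w' : finitary w -> finitary w' -> dot u (w - w') = dot u w - dot u w'.
Proof. by move=> *; rewrite dotC dotBl// ![dot u _]dotC. Qed.

Lemma dot_finitaryDr u w w' : finitary u -> dot u (w + w') = dot u w + dot u w'.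
Proof.
move=> /finitary_uniq[s us h]; rewrite !(@dotE s)//; try by move=> n ns; rewrite h ?mul0r.
by rewrite -big_split; apply: eq_bigr => i _; rewrite fctE mulrDr.
Qed.

Lemma dot_ge0 u : 0 <= dot u u.
Proof. by apply: fsumr_ge0 => n _; rewrite -expr2 sqr_ge0. Qed.

Lemma dot_translate j u w : dot (translate j u) (translate j w) = dot u w.
Proof.
rewrite /dot (reindex_fsbigT (fun n : int => n + j) (fun n => u n * w n))//.
by exists (fun n => n - j) => n; rewrite ?addrK ?subrK.
Qed.

Lemma dot_translatel j u w : dot (translate j u) w = dot u (translate (- j) w).
Proof.
rewrite -(dot_translate (- j)); congr dot; apply/funext => n.
by rewrite /translate subrK.
Qed.

Lemma dot_deltal i w : dot (delta i) w = w i.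
Proof.
rewrite (@dotE [:: i])//; first by rewrite big_seq1 /delta eqxx mul1r.
by move=> n; rewrite inE /delta => /negbTE ->; rewrite mul0r.
Qed.

Lemma dot_deltar i w : dot w (delta i) = w i.
Proof. by rewrite dotC dot_deltal. Qed.

Lemma sum_le_dot (s : seq int) u : uniq s -> finitary u ->
  \sum_(n <- s) u n ^+ 2 <= dot u u.
Proof.
move=> us [t h]; pose r := undup (s ++ t).
rewrite (@dotE r) ?undup_uniq//; last first.
  by move=> n; rewrite mem_undup mem_cat negb_or => /andP[_ nt]; rewrite h ?mul0r.
rewrite [leRHS](bigID (mem s))/= -[leLHS]addr0; apply: lerD; last first.
  by apply: sumr_ge0 => n _; rewrite -expr2 sqr_ge0.
rewrite -[leRHS]big_filter; under [leRHS]eq_bigr do rewrite -expr2.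
rewrite le_eqVlt; apply/orP; left; apply/eqP/perm_big/uniq_perm => //.
  by rewrite filter_uniq// undup_uniq.
move=> n; rewrite mem_filter mem_undup mem_cat.
by case: (n \in s).
Qed.

Lemma dot_gt0 u n : finitary u -> u n != 0 -> 0 < dot u u.
Proof.
move=> fu un; apply: lt_le_trans (@sum_le_dot [:: n] u _ fu) => //.
by rewrite big_seq1 exprn_even_gt0.
Qed.

Lemma dot_eq0 u : finitary u -> dot u u = 0 -> u = 0.
Proof.
move=> fu u0; apply/funext => n; apply/eqP; apply: contraPT (u0) => un.
by apply/eqP; rewrite gt_eqF//; exact: (dot_gt0 fu un).
Qed.

Lemma discriminant (a b c : R) : 0 <= c ->
  (forall t, 0 <= a + t * b *+ 2 + t ^+ 2 * c) -> b ^+ 2 <= a * c.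
Proof.
move=> c_ge0 h; have [c0|c0] := eqVneq c 0.
  have [->|b0] := eqVneq b 0; first by rewrite c0 mulr0 expr0n.
  have := h (- (a + 1) / (2 * b)); rewrite c0.
  have -> : a + - (a + 1) / (2 * b) * b *+ 2 + (- (a + 1) / (2 * b)) ^+ 2 * 0 = -1.
    by field.
  by rewrite ler0N1.
have c_gt0 : 0 < c by rewrite lt_neqAle eq_sym c0.
have := h (- (b / c)).
have -> : a + - (b / c) * b *+ 2 + (- (b / c)) ^+ 2 * c = a - b ^+ 2 / c by field.
by rewrite subr_ge0 ler_pdivrMr.
Qed.

Lemma dot_CS u w : finitary u -> finitary w -> dot u w ^+ 2 <= dot u u * dot w w.
Proof.
move=> fu fw; apply: discriminant => [|t]; first exact: dot_ge0.
suff <- : dot (u + t *: w) (u + t *: w) =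
    dot u u + t * dot u w *+ 2 + t ^+ 2 * dot w w by exact: dot_ge0.
rewrite dotDl ?dotDr; auto; rewrite !(dotZl, dotZr) (dotC w u); ring.
Qed.

Lemma dotD_le u w : finitary u -> finitary w ->
  dot (u + w) (u + w) <= 2 * dot u u + 2 * dot w w.
Proof.
move=> fu fw; have := dot_ge0 (u - w).
rewrite !dotDl ?dotDr; auto; rewrite !(dotNl, dotNr) (dotC w u); lra.
Qed.

(** * Symmetric operators *)

(** The sequence [w] in [symop_sym] is arbitrary, so that operators can also be
    moved from finitary vectors onto square-summable ones. *)
Record symop (P : (int -> R) -> (int -> R)) : Prop := Symop {
  symop_finitary : forall u, finitary u -> finitary (P u);
  symop_D : forall u w, P (u + w) = P u + P w;
  symop_Z : forall c u, P (c *: u) = c *: P u;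
  symop_sym : forall u w, finitary u -> dot (P u) w = dot u (P w) }.

(** The Schroedinger operator with potential [v]; the energy is absorbed in the
    potential, see [shift_energy]. *)
Definition jacobi v u : int -> R := fun n => u (n + 1) + u (n - 1) + v n * u n.

Lemma symop_jacobi v : symop (jacobi v).
Proof.
split.
- move=> u fu.
  by apply: finitaryD (finitaryM _ fu);
    apply: finitaryD (finitary_translate 1 fu) (finitary_translate (-1) fu).
- by move=> u w; apply/funext => n; rewrite /jacobi !fctE; ring.
- by move=> c u; apply/funext => n; rewrite /jacobi !fctE /GRing.scale/=; ring.
- move=> u w fu.
  have -> : jacobi v u = translate 1 u + translate (-1) u + (fun n => v n * u n) by [].
  have -> : jacobi v w = translate (-1) w + translate 1 w + (fun n => v n * w n).
    by apply/funext => n; rewrite /jacobi !fctE /translate; ring.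
  rewrite !dotDl; auto.
  rewrite !dot_finitaryDr// !dot_translatel opprK; congr (_ + _).
  by apply: eq_fsbigr => n _; ring.
Qed.

Lemma symopD P Q : symop P -> symop Q -> symop (fun u => P u + Q u).
Proof.
move=> sP sQ; split.
- by move=> u fu; apply: finitaryD; [exact: (symop_finitary sP)|exact: (symop_finitary sQ)].
- by move=> u w; rewrite (symop_D sP) (symop_D sQ) addrACA.
- by move=> c u; rewrite (symop_Z sP) (symop_Z sQ) scalerDr.
- move=> u w fu; rewrite dotDl; [|exact: (symop_finitary sP)|exact: (symop_finitary sQ)].
  by rewrite dot_finitaryDr// (symop_sym sP)// (symop_sym sQ).
Qed.

Lemma symopZ k P : symop P -> symop (fun u => k *: P u).
Proof.
move=> sP; split.
- by move=> u fu; apply: finitaryZ; exact: (symop_finitary sP).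
- by move=> u w; rewrite (symop_D sP) scalerDr.
- by move=> c u; rewrite (symop_Z sP) !scalerA mulrC.
- by move=> u w fu; rewrite dotZl dotZr (symop_sym sP).
Qed.

Lemma symop_id : symop id. Proof. by []. Qed.

Lemma symop_sqr P : symop P -> symop (fun u => P (P u)).
Proof.
move=> sP; split.
- by move=> u fu; do 2 apply: (symop_finitary sP).
- by move=> u w; rewrite !(symop_D sP).
- by move=> c u; rewrite !(symop_Z sP).
- by move=> u w fu; rewrite !(symop_sym sP)//; exact: (symop_finitary sP).
Qed.

Lemma symop_CS P u w : symop P -> (forall u, finitary u -> 0 <= dot (P u) u) ->
  finitary u -> finitary w -> dot (P u) w ^+ 2 <= dot (P u) u * dot (P w) w.
Proof.
move=> sP P0 fu fw; apply: discriminant => [|t]; first exact: P0.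
suff <- : dot (P (u + t *: w)) (u + t *: w) =
    dot (P u) u + t * dot (P u) w *+ 2 + t ^+ 2 * dot (P w) w.
  by apply: P0; apply: finitaryD => //; exact: finitaryZ.
have fPu := symop_finitary sP fu; have fPw := symop_finitary sP fw.
rewrite (symop_D sP) (symop_Z sP) dotDl ?dotDr; auto.
rewrite !(dotZl, dotZr) (symop_sym sP u fw) (dotC w (P u)); ring.
Qed.

(** The Cauchy-Schwarz inequality for the form of [P], applied to [u] and
    [P u].  It turns bounds on a nonnegative form into bounds on norms. *)
Lemma symop_sqr_le P K u : symop P -> 0 <= K -> (forall u, finitary u -> 0 <= dot (P u) u) ->
  (forall u, finitary u -> dot (P u) u <= K * dot u u) ->
  finitary u -> dot (P u) (P u) <= K * dot (P u) u.
Proof.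
move=> sP K0 P0 PK fu; have fPu := symop_finitary sP fu.
have [d0|d0] := eqVneq (dot (P u) (P u)) 0; first by rewrite d0 mulr_ge0// P0.
have dgt0 : 0 < dot (P u) (P u) by rewrite lt_neqAle eq_sym d0 dot_ge0.
have := symop_CS sP P0 fu fPu; rewrite expr2 => h.
rewrite -(ler_pM2r dgt0); apply: le_trans h _.
rewrite (mulrC K) -mulrA; apply: ler_wpM2l; first exact: P0.
exact: PK.
Qed.

End finitely_supported.
#[local] Hint Resolve finitary0 finitaryM finitaryD finitaryZ finitaryN : core.
#[local] Hint Resolve finitary_delta finitary_translate : core.

(** * Bounds from below *)

Section lower_bounds.
Context {R : realType}.
Implicit Types (u v w : int -> R) (k c e d : R) (A : set (int -> R)).

(** [k] is the square of the usual constant: only squared norms occur here. *)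
Definition bounded_below k v :=
  forall u, finitary u -> k * dot u u <= dot (jacobi v u) (jacobi v u).

Definition shift_energy v e : int -> R := fun n => v n - e.

Lemma finitary_jacobi v u : finitary u -> finitary (jacobi v u).
Proof. by move/(symop_finitary (symop_jacobi v)). Qed.
#[local] Hint Resolve finitary_jacobi : core.

Lemma jacobi_shift_energy v e u : jacobi (shift_energy v e) u = jacobi v u - e *: u.
Proof. by apply/funext => n; rewrite /jacobi /shift_energy !fctE /GRing.scale/=; ring. Qed.

Lemma dot_mul_le v u C : finitary u -> (forall n, u n != 0 -> v n ^+ 2 <= C) ->
  dot (fun n => v n * u n) (fun n => v n * u n) <= C * dot u u.
Proof.
move=> fu vC; have [s us h] := finitary_uniq fu.
rewrite !(@dotE _ s)//; try by move=> n ns; rewrite h ?(mul0r, mulr0).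
rewrite mulr_sumr; apply: ler_sum => n _.
have [->|un] := eqVneq (u n) 0; first by rewrite !mulr0.
by rewrite -!expr2 exprMn ler_wpM2r ?sqr_ge0// vC.
Qed.

Lemma jacobi_bound M v u : (forall n, `|v n| <= M) -> finitary u ->
  dot (jacobi v u) (jacobi v u) <= (6 + 4 * M ^+ 2) * dot u u.
Proof.
move=> vM fu.
have -> : jacobi v u = translate 1 u + (translate (-1) u + (fun n => v n * u n)).
  by apply/funext => n; rewrite /jacobi !fctE addrA.
apply: le_trans (dotD_le _ _) _; auto.
rewrite dot_translate.
have := @dotD_le _ (translate (-1) u) (fun n => v n * u n).
move=> /(_ (finitary_translate _ fu) (finitaryM _ fu)).
rewrite dot_translate.
have : dot (fun n => v n * u n) (fun n => v n * u n) <= M ^+ 2 * dot u u.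
  apply: dot_mul_le => // n _; rewrite -[v n ^+ 2]real_normK ?num_real//.
  by rewrite ler_pXn2r ?nnegrE// (le_trans (normr_ge0 _) (vM n)).
by have := dot_ge0 u; nra.
Qed.

(** A bound from below survives, up to the factor 4, a change of the potential
    which is small on the support of the tested vector only. *)
Lemma bounded_below_perturb k v v' u : bounded_below k v' -> finitary u ->
  (forall n, u n != 0 -> (v' n - v n) ^+ 2 <= k / 4) ->
  k / 4 * dot u u <= dot (jacobi v u) (jacobi v u).
Proof.
move=> lv fu h.
have := lv u fu.
have -> : jacobi v' u = jacobi v u + (fun n => (v' n - v n) * u n).
  by apply/funext => n; rewrite /jacobi !fctE; ring.
have := @dotD_le _ (jacobi v u) (fun n => (v' n - v n) * u n) (finitary_jacobi v fu) (finitaryM _ fu).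
have := @dot_mul_le (fun n => v' n - v n) u _ fu h.
lra.
Qed.

Lemma sqr_jacobi_shift v c u :
  jacobi (shift_energy v (- c)) (jacobi (shift_energy v c) u) =
  jacobi v (jacobi v u) - c ^+ 2 *: u.
Proof.
rewrite !jacobi_shift_energy -scaleN1r !(symop_D (symop_jacobi v)) !(symop_Z (symop_jacobi v)).
apply/funext => n; rewrite !fctE /GRing.scale/=; ring.
Qed.

(** For a bounded symmetric operator the best constant c satisfies that c or - c
    is in the spectrum: otherwise both factors of J ^ 2 - c ^ 2 are bounded
    below, and [symop_sqr_le] for this nonnegative operator improves c. *)
Lemma bounded_below_distance A M d : A !=set0 -> (forall v, A v -> forall n, `|v n| <= M) ->
  0 <= d ->
  (forall e, `|e| <= d ->
    exists2 k, 0 < k & forall v, A v -> bounded_below k (shift_energy v e)) ->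
  exists2 k, d ^+ 2 < k & forall v, A v -> bounded_below k v.
Proof.
move=> [v0 Av0] AM d0 h.
have shift0 v : shift_energy v 0 = v by apply/funext => n; rewrite /shift_energy subr0.
pose S := [set k | forall v, A v -> bounded_below k v].
have Sub : ubound S (dot (jacobi v0 (delta 0)) (jacobi v0 (delta 0))).
  move=> k /(_ _ Av0 _ (finitary_delta 0)).
  by rewrite dot_deltal /delta eqxx mulr1.
have S0 : S 0 by move=> v _ u _; rewrite mul0r dot_ge0.
have supS : has_sup S.
  by split; [exists 0|exists (dot (jacobi v0 (delta 0)) (jacobi v0 (delta 0)))].
pose K := sup S.
have K0 : 0 <= K by apply: ub_le_sup => //; case: supS.
have SK : S K.
  move=> v Av u fu; have := dot_ge0 u; rewrite le_eqVlt => /orP[/eqP<-|u0].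
    by rewrite mulr0 dot_ge0.
  rewrite -ler_pdivlMr//; apply: sup_le_ub; first by exists 0.
  by move=> k Sk; rewrite ler_pdivlMr//; exact: Sk.
exists K; last exact: SK.
(* K is the best constant; if c = sqrt K <= d, both shifts by c are allowed *)
rewrite ltNge; apply/negP => Kd.
pose c := Num.sqrt K.
have cK : c ^+ 2 = K by rewrite sqr_sqrtr.
have c0 : 0 <= c by rewrite sqrtr_ge0.
have cd : c <= d by rewrite -(@ler_pXn2r _ 2) ?nnegrE// cK.
have [k1 k1_gt0 l1] := h c ltac:(by rewrite ger0_norm).
have [k2 k2_gt0 l2] := h (- c) ltac:(by rewrite normrN ger0_norm).
pose C := 6 + 4 * M ^+ 2.
have C0 : 0 < C by rewrite /C; have := sqr_ge0 M; lra.
suff : S (K + k1 * k2 / C).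
  move=> /(ub_le_sup (proj2 supS)); rewrite -/K gerDl leNgt => /negP; apply.
  by rewrite divr_gt0// mulr_gt0.
move=> v Av u fu.
pose P u := jacobi v (jacobi v u) + (- K) *: u.
have sP : symop P.
  by apply: symopD; [exact/symop_sqr/symop_jacobi|exact: symopZ (symop_id)].
have PE u' : P u' = jacobi (shift_energy v (- c)) (jacobi (shift_energy v c) u').
  by rewrite sqr_jacobi_shift cK /P scaleNr.
have Pdot u' : finitary u' -> dot (P u') u' = dot (jacobi v u') (jacobi v u') - K * dot u' u'.
  move=> fu'; rewrite /P dotDl; auto.
  by rewrite (symop_sym (symop_jacobi v)) ?dotZl ?mulNr//; auto.
have P0 u' : finitary u' -> 0 <= dot (P u') u'.
  by move=> fu'; rewrite Pdot// subr_ge0; exact: SK.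
have PC u' : finitary u' -> dot (P u') u' <= C * dot u' u'.
  move=> fu'; rewrite Pdot//; apply: le_trans (jacobi_bound (AM _ Av) fu').
  by rewrite gerBl mulr_ge0// dot_ge0.
have := symop_sqr_le sP (ltW C0) P0 PC fu; rewrite Pdot// PE => PPC.
have g2 := l2 _ Av _ (finitary_jacobi (shift_energy v c) fu).
have g1 := ler_wpM2l (ltW k2_gt0) (l1 _ Av _ fu).
have := le_trans (le_trans g1 g2) PPC.
rewrite -ler_pdivrMl// mulrDl.
have -> : C^-1 * (k2 * (k1 * dot u u)) = k1 * k2 / C * dot u u by ring.
by lra.
Qed.

(** The extreme values of the quadratic forms are spectral points: were
    m - s J bounded below, [symop_sqr_le] would lower the supremum m.  The sign
    [s] is 1 for the upper end and -1 for the lower one. *)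
Lemma form_extremum A M (s : R) : A !=set0 -> (forall v, A v -> forall n, `|v n| <= M) ->
  s ^+ 2 = 1 ->
  exists2 m, (forall v u, A v -> finitary u -> s * dot (jacobi v u) u <= m * dot u u) &
    ~ exists2 k, 0 < k & forall v, A v -> bounded_below k (shift_energy v (s * m)).
Proof.
move=> [v0 Av0] AM s1.
pose S := [set x | exists v u, [/\ A v, finitary u, dot u u = 1 & x = s * dot (jacobi v u) u]].
pose C := 6 + 4 * M ^+ 2.
have C0 : 0 < C by rewrite /C; have := sqr_ge0 M; lra.
have form_le v u : A v -> finitary u -> s * dot (jacobi v u) u <= C * dot u u.
  move=> Av fu; have := dot_ge0 (u - s *: jacobi v u).
  rewrite dotBl; auto; rewrite !dotBr; auto; rewrite !(dotZl, dotZr) (dotC u (jacobi v u)).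
  have := jacobi_bound (AM _ Av) fu; rewrite -/C.
  rewrite !mulrA -expr2 s1 mul1r; have := dot_ge0 u; have : 6 <= C.
    by rewrite /C; have := sqr_ge0 M; lra.
  nra.
have form_ge v u : A v -> finitary u -> - (s * dot (jacobi v u) u) <= C * dot u u.
  move=> Av fu; have := dot_ge0 (u + s *: jacobi v u).
  rewrite dotDl; auto; rewrite !dotDr; auto; rewrite !(dotZl, dotZr) (dotC u (jacobi v u)).
  have := jacobi_bound (AM _ Av) fu; rewrite -/C.
  rewrite !mulrA -expr2 s1 mul1r; have := dot_ge0 u; have : 6 <= C.
    by rewrite /C; have := sqr_ge0 M; lra.
  nra.
have S0 : S !=set0.
  exists (s * dot (jacobi v0 (delta 0)) (delta 0)); exists v0, (delta 0); split => //.
  by rewrite dot_deltal /delta eqxx.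
have Sub : has_ubound S.
  by exists C => x [v [u [Av fu u1 ->]]]; apply: le_trans (form_le _ _ Av fu) _; rewrite u1 mulr1.
pose m := sup S.
have mP v u : A v -> finitary u -> s * dot (jacobi v u) u <= m * dot u u.
  move=> Av fu; have [u0|u0] := eqVneq (dot u u) 0.
    by rewrite u0 (dot_eq0 fu u0) -[X in dot _ X](scale0r u) dotZr !(mul0r, mulr0).
  have ugt0 : 0 < dot u u by rewrite lt_neqAle eq_sym u0 dot_ge0.
  pose a := Num.sqrt (dot u u).
  have a0 : 0 < a by rewrite sqrtr_gt0.
  have aE : a ^+ 2 = dot u u by rewrite sqr_sqrtr// dot_ge0.
  rewrite -ler_pdivrMr// -aE; apply: ub_le_sup => //.
  exists v, (a^-1 *: u); split; auto.
    by rewrite dotZl dotZr -aE; field; rewrite gt_eqF.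
  by rewrite (symop_Z (symop_jacobi v)) dotZl dotZr; field; rewrite gt_eqF.
exists m => // -[k k0 lk].
have mle v u : A v -> finitary u -> s * dot (jacobi v u) u <= (m - k / (C + `|m|)) * dot u u.
  move=> Av fu.
  pose P u := m *: u + (- s) *: jacobi v u.
  have sP : symop P by apply: symopD; [exact: symopZ (symop_id)|exact: symopZ (symop_jacobi v)].
  have Pdot u' : finitary u' -> dot (P u') u' = m * dot u' u' - s * dot (jacobi v u') u'.
    by move=> fu'; rewrite /P dotDl; auto; rewrite !dotZl mulNr.
  have K0 : 0 < C + `|m| by rewrite ltr_pwDl.
  have P0 u' : finitary u' -> 0 <= dot (P u') u'.
    by move=> fu'; rewrite Pdot// subr_ge0; exact: mP.
  have PC u' : finitary u' -> dot (P u') u' <= (C + `|m|) * dot u' u'.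
    move=> fu'; rewrite Pdot// mulrDl.
    have : m * dot u' u' <= `|m| * dot u' u' by rewrite ler_wpM2r ?dot_ge0// ler_norm.
    by have := form_ge v u' Av fu'; lra.
  have PE : P u = (- s) *: jacobi (shift_energy v (s * m)) u.
    rewrite jacobi_shift_energy scalerBr scalerA /P addrC; congr (_ + _).
    by rewrite -scaleNr; congr (_ *: _); rewrite mulNr opprK mulrA -expr2 s1 mul1r.
  have := symop_sqr_le sP (ltW K0) P0 PC fu; rewrite Pdot// PE.
  rewrite dotZl dotZr mulrA -expr2 sqrrN s1 mul1r => h.
  have := le_trans (lk _ Av _ fu) h; rewrite -ler_pdivrMl// mulrBl.
  have -> : (C + `|m|)^-1 * (k * dot u u) = k / (C + `|m|) * dot u u by ring.
  by lra.
have : m <= m - k / (C + `|m|).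
  apply: sup_le_ub => // x [v [u [Av fu u1 ->]]].
  by apply: le_trans (mle _ _ Av fu) _; rewrite u1 mulr1.
by have : 0 < k / (C + `|m|) by [rewrite divr_gt0// ltr_pwDl]; lra.
Qed.

(** The values of w stay at distance d from - [m, M].  Split u = a + b according
    to the side on which w lies, and pair the image of u with a - b: the cross
    terms cancel by symmetry, and both pieces contribute positively. *)
Lemma bounded_below_outside v w (m M d : R) : 0 <= d ->
  (forall u, finitary u -> m * dot u u <= dot (jacobi v u) u) ->
  (forall u, finitary u -> dot (jacobi v u) u <= M * dot u u) ->
  (forall n, d - m <= w n \/ w n <= - M - d) ->
  bounded_below (d ^+ 2) (v + w).
Proof.
move=> d0 vm vM hw u fu.
pose up n := d - m <= w n.
pose a : int -> R := fun n => (up n)%:R * u n.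
pose b : int -> R := fun n => (~~ up n)%:R * u n.
have fa : finitary a by exact: finitaryM.
have fb : finitary b by exact: finitaryM.
have uE : u = a + b.
  by apply/funext => n; rewrite /a /b fctE; case: (up n); rewrite !(mul0r, mul1r, addr0, add0r).
have abE : dot a b = 0.
  by apply: fsbig1 => n _; rewrite /a /b; case: (up n); rewrite !(mul0r, mulr0).
have JvwE z : jacobi (v + w) z = jacobi v z + (fun n => w n * z n).
  by apply/funext => n; rewrite /jacobi !fctE; ring.
have ha : (d - m) * dot a a <= dot (fun n => w n * a n) a.
  rewrite -dotZl; have [s us h] := finitary_uniq fa.
  rewrite !(@dotE _ s)//; try by move=> n ns; rewrite h ?(mul0r, mulr0).
  apply: ler_sum => n _; rewrite /a fctE /GRing.scale/=.
  case: (boolP (up n)) => hn; last by rewrite !(mul0r, mulr0).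
  by rewrite !mul1r -!mulrA -expr2 ler_wpM2r// sqr_ge0.
have hb : (M + d) * dot b b <= - dot (fun n => w n * b n) b.
  rewrite -dotZl -dotNl; have [s us h] := finitary_uniq fb.
  rewrite !(@dotE _ s)//; try by move=> n ns; rewrite ?fctE h ?(oppr0, mul0r, mulr0).
  apply: ler_sum => n _; rewrite /b !fctE /GRing.scale/=.
  case: (boolP (up n)) => hn/=; first by rewrite !(mul0r, mulr0).
  have wn : M + d <= - w n by case: (hw n) => // h1; [rewrite /up h1 in hn|lra].
  by have := ler_wpM2r (sqr_ge0 (u n)) wn; lra.
have hd : d * dot u u <= dot (jacobi (v + w) u) (a - b).
  have fxa := finitary_jacobi v fa; have fxb := finitary_jacobi v fb.
  have := vm a fa; have := vM b fb.
  have e1 : dot (fun n => w n * a n) b = 0.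
    by apply: fsbig1 => n _; rewrite /a /b; case: (up n); rewrite !(mul0r, mulr0).
  have e2 : dot (fun n => w n * b n) a = 0.
    by apply: fsbig1 => n _; rewrite /a /b; case: (up n); rewrite !(mul0r, mulr0).
  have : dot (jacobi v a) b = dot (jacobi v b) a by rewrite (symop_sym (symop_jacobi v))// dotC.
  rewrite uE (symop_D (symop_jacobi (v + w))) !JvwE.
  move: (jacobi v a) (jacobi v b) fxa fxb => x y fx fy e3 h1 h2.
  move: (fun n => w n * a n) (fun n => w n * b n) (finitaryM w fa) (finitaryM w fb) ha hb e1 e2.
  move=> x' y' fx' fy' ha hb e1 e2.
  rewrite (dotDl _ (finitaryD fx fx') (finitaryD fy fy')) (dotDl _ fx fx') (dotDl _ fy fy').
  rewrite !(dotBr _ fa fb) (dotDl _ fa fb) !(dotDr _ fa fb) (dotC b a) abE.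
  by lra.
have abd : dot (a - b) (a - b) = dot u u.
  rewrite uE dotBl; auto; rewrite !dotBr; auto; rewrite dotDl; auto; rewrite !dotDr; auto.
  by rewrite (dotC b a) abE; ring.
have := dot_CS (finitary_jacobi (v + w) fu) (finitaryB fa fb); rewrite abd => CS.
have := dot_ge0 u; rewrite le_eqVlt => /orP[/eqP<-|u0].
  by rewrite mulr0 dot_ge0.
rewrite -(ler_pM2r u0); apply: le_trans CS.
rewrite -mulrA -expr2 -exprMn ler_pXn2r ?nnegrE ?mulr_ge0 ?dot_ge0//.
by apply: le_trans hd; rewrite mulr_ge0 ?dot_ge0.
Qed.

End lower_bounds.
#[local] Hint Resolve finitary_jacobi : core.

(** * Square-summable sequences *)

Section square_summable.
Context {R : realType}.
Implicit Types (u v w : int -> R) (k c C : R).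

Lemma dot0l w : dot 0 w = 0.
Proof. by rewrite -[X in dot X _](scale0r w) dotZl mul0r. Qed.

(** Bounding finite partial sums avoids infinite sums, and is stable under
    pointwise limits ([l2_lim]). *)
Definition l2 C u := forall s : seq int, uniq s -> \sum_(n <- s) u n ^+ 2 <= C.

Lemma l2_ge0 C u : l2 C u -> 0 <= C.
Proof. by move=> /(_ [::] isT); rewrite big_nil. Qed.

Lemma l2_le C C' u : C <= C' -> l2 C u -> l2 C' u.
Proof. by move=> CC h s us; apply: le_trans (h s us) CC. Qed.

Lemma l2_at C u n : l2 C u -> u n ^+ 2 <= C.
Proof. by move=> /(_ [:: n] isT); rewrite big_seq1. Qed.

Lemma l2_finitary u : finitary u -> l2 (dot u u) u.
Proof. by move=> fu s us; exact: sum_le_dot. Qed.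

Lemma l2Z C c u : l2 C u -> l2 (c ^+ 2 * C) (c *: u).
Proof.
move=> h s us.
have -> : \sum_(n <- s) (c *: u) n ^+ 2 = c ^+ 2 * \sum_(n <- s) u n ^+ 2.
  by rewrite mulr_sumr; apply: eq_bigr => n _; rewrite fctE exprMn.
by rewrite ler_wpM2l ?sqr_ge0// h.
Qed.

(** The weight lets a contraction absorb an added term without any loss in its
    factor: take [t] small. *)
Lemma l2D_weight (t : R) C C' u w : 0 < t -> l2 C u -> l2 C' w ->
  l2 ((1 + t^-1) * C + (1 + t) * C') (u + w).
Proof.
move=> t0 hu hw s us.
apply: (@le_trans _ _ ((1 + t^-1) * \sum_(n <- s) u n ^+ 2 +
                       (1 + t) * \sum_(n <- s) w n ^+ 2)).
  rewrite !mulr_sumr -big_split/=; apply: ler_sum => n _; rewrite fctE.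
  rewrite -subr_ge0.
  have -> : (1 + t^-1) * u n ^+ 2 + (1 + t) * w n ^+ 2 - (u n + w n) ^+ 2 =
            t^-1 * (u n - t * w n) ^+ 2 by field; rewrite gt_eqF.
  by rewrite mulr_ge0 ?sqr_ge0// invr_ge0 ltW.
have ti : 0 < t^-1 by rewrite invr_gt0.
by apply: lerD; rewrite ler_pM2l ?(hu, hw)//; lra.
Qed.

Lemma l2D C C' u w : l2 C u -> l2 C' w -> l2 (2 * C + 2 * C') (u + w).
Proof. by move=> /(l2D_weight (@ltr01 R)) h /h; rewrite invr1. Qed.

Lemma cvg_sum_seq (I : Type) (s : seq I) (f : I -> nat -> R) (a : I -> R) :
  (forall i, f i m @[m --> \oo] --> a i) ->
  \sum_(i <- s) f i m @[m --> \oo] --> \sum_(i <- s) a i.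
Proof. by move=> h; apply: cvg_big => //; exact: add_continuous. Qed.

Lemma l2_lim C (W : nat -> int -> R) w : (forall m, l2 C (W m)) ->
  (forall n, W m n @[m --> \oo] --> w n) -> l2 C w.
Proof.
move=> lW cW s us.
have c : \sum_(n <- s) W m n ^+ 2 @[m --> \oo] --> \sum_(n <- s) w n ^+ 2.
  apply: (@cvg_sum_seq _ s (fun n m => W m n ^+ 2) (fun n => w n ^+ 2)) => n.
  by rewrite expr2; under eq_fun do rewrite expr2; apply: cvgM; exact: cW.
by apply: (cvgr_to_le c); near=> m; exact: lW.
Unshelve. all: by end_near. Qed.

Definition cutoff (t : seq int) u : int -> R := fun n => (n \in t)%:R * u n.

Lemma finitary_cutoff t u : finitary (cutoff t u).
Proof. by exists t => n /negbTE nt; rewrite /cutoff nt mul0r. Qed.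

Lemma dot_cutoff t u C : l2 C u -> dot (cutoff t u) (cutoff t u) <= C.
Proof.
move=> h; rewrite (@dotE _ (undup t)) ?undup_uniq//; last first.
  by move=> n; rewrite mem_undup /cutoff => /negbTE ->; rewrite !mul0r.
apply: le_trans (h _ (undup_uniq t)); rewrite !big_seq; apply: ler_sum => n.
by rewrite mem_undup /cutoff => ->; rewrite mul1r -expr2.
Qed.

(** Finite range: on a finite set, a sequence can be replaced by a truncation of
    it, so that bounds for finitary sequences extend to square-summable ones
    ([local_l2]). *)
Definition local_operator (L : (int -> R) -> (int -> R)) := forall s : seq int,
  exists t : seq int, forall u u', {in t, u =1 u'} -> {in s, L u =1 L u'}.

Lemma local_jacobi v : local_operator (jacobi v).
Proof.
move=> s; exists (s ++ [seq n + 1 | n <- s] ++ [seq n - 1 | n <- s]) => u u' h n ns.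
rewrite /jacobi !h// !mem_cat ?ns//.
- by rewrite (map_f (fun n => n - 1)) ?orbT.
- by rewrite (map_f (fun n => n + 1)) ?orbT.
Qed.

Lemma local_comp L L' : local_operator L -> local_operator L' -> local_operator (L \o L').
Proof.
move=> l l' s; have [t ht] := l s; have [t' ht'] := l' t.
by exists t' => u u' h; apply: ht; apply: ht'.
Qed.

Lemma local_l2 L C c u : local_operator L ->
  (forall u, finitary u -> finitary (L u)) -> 0 <= c ->
  (forall u, finitary u -> dot (L u) (L u) <= c * dot u u) -> l2 C u -> l2 (c * C) (L u).
Proof.
move=> lL fL c0 h lu s us; have [t ht] := lL s.
have -> : \sum_(n <- s) L u n ^+ 2 = \sum_(n <- s) L (cutoff t u) n ^+ 2.
  rewrite !big_seq; apply: eq_bigr => n ns; congr (_ ^+ 2); apply: ht => // m mt.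
  by rewrite /cutoff mt mul1r.
have fr := finitary_cutoff t u.
apply: le_trans (sum_le_dot us (fL _ fr)) _; apply: le_trans (h _ fr) _.
by rewrite ler_wpM2l// dot_cutoff.
Qed.

Lemma cvg_jacobi v (W : nat -> int -> R) w : (forall n, W m n @[m --> \oo] --> w n) ->
  forall n, jacobi v (W m) n @[m --> \oo] --> jacobi v w n.
Proof.
by move=> h n; apply: cvgD; [apply: cvgD; exact: h|apply: cvgM; [exact: cvg_cst|exact: h]].
Qed.

Lemma cvg_dot (W : nat -> int -> R) w u : finitary u ->
  (forall n, W m n @[m --> \oo] --> w n) -> dot (W m) u @[m --> \oo] --> dot w u.
Proof.
move=> /finitary_uniq[s us h] cW; rewrite (@dotE _ s)//; last by move=> n ns; rewrite h ?mulr0.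
have -> : (fun m => dot (W m) u) = (fun m => \sum_(n <- s) W m n * u n).
  by apply/funext => m; rewrite (@dotE _ s)// => n ns; rewrite h ?mulr0.
apply: (@cvg_sum_seq _ s (fun n m => W m n * u n) (fun n => w n * u n)) => n.
by apply: cvgM; [exact: cW|exact: cvg_cst].
Qed.

End square_summable.

(** * The inverse of a Jacobi operator bounded below *)

Section resolvent.
Context {R : realType}.
Variable M : R.
Implicit Types (u v w : int -> R) (k c C : R).

Let K : R := 6 + 4 * M ^+ 2.
Let K_gt0 : 0 < K. Proof. by rewrite /K; have := sqr_ge0 M; lra. Qed.

(** If k <= J ^ 2 <= K then 1 - J ^ 2 / K has norm at most 1 - k / K < 1, so
    that the Neumann series gives the inverse of J ^ 2 / K, and J ^ -1 is
    K ^ -1 times J applied to it. *)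
Definition neumann v u : int -> R := u - K^-1 *: jacobi v (jacobi v u).

Definition neumann_sum v m u : int -> R := \sum_(0 <= j < m) iter j (neumann v) u.

Definition neumann_lim v u : int -> R := fun n => lim (neumann_sum v m u n @[m --> \oo]).

Definition resolvent v u : int -> R := K^-1 *: jacobi v (neumann_lim v u).

(** Twice [t] is 1 minus the square of the contraction factor.  The expression
    after K ^ -1 bounds the squared norms of the partial sums for a unit vector:
    the recursion for them, obtained from [l2D_weight] with weight [t], does not
    leave this bound.  All potentials with the same [M] and [k] share it. *)
Definition resolvent_bound k : R :=
  let t := (1 - (1 - k / K) ^+ 2) / 2 in K^-1 * ((1 + t^-1) / t).

Let symop_neumann v : symop (neumann v).
Proof.
have -> : neumann v = (fun u => u + (- K^-1) *: jacobi v (jacobi v u)).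
  by apply/funext => u; rewrite /neumann scaleNr.
by apply: symopD; [exact: symop_id|exact/symopZ/symop_sqr/symop_jacobi].
Qed.

Let local_neumann v : local_operator (neumann v).
Proof.
move=> s; have [t ht] := local_comp (local_jacobi v) (local_jacobi v) s.
exists (s ++ t) => u u' h n ns; rewrite /neumann !fctE h ?mem_cat ?ns//.
by rewrite [jacobi v (jacobi v u) n](ht u u')// => m mt; apply: h; rewrite mem_cat mt orbT.
Qed.

Let neumann_jacobi v u : neumann v (jacobi v u) = jacobi v (neumann v u).
Proof.
by apply/funext => n; rewrite /neumann /jacobi !fctE /GRing.scale/=; ring.
Qed.

Let iter_neumann_jacobi v j u :
  iter j (neumann v) (jacobi v u) = jacobi v (iter j (neumann v) u).
Proof. by elim: j => //= j ->; exact: neumann_jacobi. Qed.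

Let sumE v m u n : neumann_sum v m u n = \sum_(0 <= j < m) iter j (neumann v) u n.
Proof. by rewrite /neumann_sum fct_sumE. Qed.

Let neumann_sumS v m u : neumann_sum v m.+1 u = u + neumann v (neumann_sum v m u).
Proof.
rewrite /neumann_sum big_nat_recl//=; congr (_ + _).
elim: m => [|m IH].
  by rewrite !big_nil -[X in neumann _ X](scale0r u) (symop_Z (symop_neumann v)) scale0r.
by rewrite !big_nat_recr//= IH (symop_D (symop_neumann v)).
Qed.

Let neumann_sum_jacobi v m u : neumann_sum v m (jacobi v u) = jacobi v (neumann_sum v m u).
Proof.
rewrite /neumann_sum; elim: m => [|m IH].
  by rewrite !big_nil -[X in jacobi _ X](scale0r u) (symop_Z (symop_jacobi v)) scale0r.
by rewrite !big_nat_recr//= IH (symop_D (symop_jacobi v)) iter_neumann_jacobi.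
Qed.

Let finitary_iter v j u : finitary u -> finitary (iter j (neumann v) u).
Proof. by move=> fu; elim: j => //= j; exact: (symop_finitary (symop_neumann v)). Qed.

Let finitary_neumann_sum v m u : finitary u -> finitary (neumann_sum v m u).
Proof. by move=> fu; rewrite /neumann_sum; apply: finitary_sum => j; exact: finitary_iter. Qed.

Let neumann_sum_sym v m u w : finitary u -> finitary w ->
  dot (neumann_sum v m u) w = dot u (neumann_sum v m w).
Proof.
move=> fu fw; rewrite /neumann_sum; elim: m => [|m IH].
  by rewrite !big_nil dot0l dotC dot0l.
rewrite !big_nat_recr//= dotDl; [|exact: finitary_neumann_sum|exact: finitary_iter].
rewrite dot_finitaryDr// IH; congr (_ + _).
elim: m w fw {IH} => //= m IH w fw.
by rewrite (symop_sym (symop_neumann v)) ?IH// -?iterS ?iterSr//;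
  [exact: (symop_finitary (symop_neumann v))|exact: finitary_iter].
Qed.

Section admissible.
Variables (v : int -> R) (k : R).
Hypothesis vM : forall n, `|v n| <= M.
Hypothesis k_gt0 : 0 < k.
Hypothesis lv : bounded_below k v.

Let q := 1 - k / K.

Let kK : k <= K.
Proof.
have d1 : dot (delta 0) (delta 0) = 1 :> R by rewrite dot_deltal /delta eqxx.
by have := le_trans (lv (finitary_delta 0)) (jacobi_bound vM (finitary_delta 0)); rewrite d1 !mulr1.
Qed.

Let q_ge0 : 0 <= q. Proof. by rewrite subr_ge0 ler_pdivrMr// mul1r; exact: kK. Qed.
Let q_lt1 : q < 1. Proof. by rewrite gtrBl divr_gt0. Qed.
Let q2_lt1 : q ^+ 2 < 1. Proof. by rewrite expr2; have := q_ge0; have := q_lt1; nra. Qed.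

Let neumann_le u : finitary u -> dot (neumann v u) (neumann v u) <= q ^+ 2 * dot u u.
Proof.
move=> fu.
have Ndot u' : finitary u' ->
    dot (neumann v u') u' = dot u' u' - K^-1 * dot (jacobi v u') (jacobi v u').
  move=> fu'; rewrite /neumann dotBl; auto.
  by rewrite dotZl (symop_sym (symop_jacobi v))//; auto.
have N0 u' : finitary u' -> 0 <= dot (neumann v u') u'.
  by move=> fu'; rewrite Ndot// subr_ge0 ler_pdivrMl// jacobi_bound.
have Nq u' : finitary u' -> dot (neumann v u') u' <= q * dot u' u'.
  move=> fu'; rewrite Ndot// mulrBl mul1r lerB// -mulrA mulrCA ler_pM2l ?invr_gt0//.
  exact: lv.
apply: le_trans (symop_sqr_le (symop_neumann v) q_ge0 N0 Nq fu) _.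
by rewrite expr2 -mulrA ler_wpM2l// Nq.
Qed.

Let l2_neumann C u : l2 C u -> l2 (q ^+ 2 * C) (neumann v u).
Proof.
move=> lu; apply: (local_l2 (local_neumann v)) lu; last exact: neumann_le.
  exact: (symop_finitary (symop_neumann v)).
by rewrite sqr_ge0.
Qed.

Let l2_iter C j u : l2 C u -> l2 ((q ^+ j) ^+ 2 * C) (iter j (neumann v) u).
Proof.
move=> lu; elim: j => [|j IH]; first by rewrite expr0 expr1n mul1r.
by rewrite (exprS q j) exprMn -mulrA; exact: l2_neumann.
Qed.

Let cvg_neumann C u n : l2 C u -> neumann_sum v m u n @[m --> \oo] --> neumann_lim v u n.
Proof.
move=> lu; have C0 := l2_ge0 lu.
have E : (fun m => neumann_sum v m u n) = series (fun j => iter j (neumann v) u n).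
  by apply/funext => m; exact: sumE.
rewrite /neumann_lim E.
apply: (@normed_cvg R R^o).
apply: (@series_le_cvg _ _ (geometric (Num.sqrt C) q)).
- by move=> j; rewrite normr_ge0.
- by move=> j; rewrite /geometric/= mulr_ge0 ?sqrtr_ge0// exprn_ge0.
- move=> j; rewrite /geometric/= -(@ler_pXn2r _ 2) ?nnegrE ?mulr_ge0 ?sqrtr_ge0 ?exprn_ge0//.
  rewrite real_normK ?num_real// exprMn sqr_sqrtr// mulrC.
  exact: l2_at (l2_iter j lu).
- by apply: is_cvg_geometric_series; rewrite ger0_norm.
Qed.

Let t := (1 - q ^+ 2) / 2.
Let t_gt0 : 0 < t. Proof. by rewrite /t; have := q2_lt1; lra. Qed.
Let D := (1 + t^-1) / t.

Let l2_neumann_sum C m u : l2 C u -> l2 (D * C) (neumann_sum v m u).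
Proof.
move=> lu; have C0 := l2_ge0 lu; have ti : 0 < t^-1 by rewrite invr_gt0.
have D0 : 0 <= D.
  by apply: divr_ge0; [rewrite addr_ge0// ltW|exact: ltW].
elim: m => [|m IH].
  move=> s us; rewrite /neumann_sum big_nil big1 ?(mulr_ge0 D0 C0)// => n _.
  by rewrite expr0n.
rewrite neumann_sumS; apply: l2_le (l2D_weight t_gt0 lu (l2_neumann IH)).
have -> : (1 + t^-1) * C + (1 + t) * (q ^+ 2 * (D * C)) =
    (t * D + (1 + t) * q ^+ 2 * D) * C.
  by rewrite /D; field; rewrite gt_eqF.
rewrite ler_wpM2r// -mulrDl ler_piMl//.
have -> : q ^+ 2 = 1 - 2 * t by rewrite /t; field.
by have := sqr_ge0 t; lra.
Qed.

Let l2_neumann_lim C u : l2 C u -> l2 (D * C) (neumann_lim v u).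
Proof.
move=> lu; apply: (@l2_lim _ _ (fun m => neumann_sum v m u)).
  by move=> m; exact: l2_neumann_sum.
by move=> n; exact: cvg_neumann lu.
Qed.

Lemma l2_resolvent C u : l2 C u -> l2 (resolvent_bound k * C) (resolvent v u).
Proof.
move=> lu; have := l2Z K^-1 (local_l2 (local_jacobi v) (@finitary_jacobi _ v) (ltW K_gt0)
  (fun u => jacobi_bound vM) (l2_neumann_lim lu)).
apply: l2_le; rewrite /resolvent_bound -/q -/t -/D le_eqVlt.
by apply/orP; left; apply/eqP; field; rewrite gt_eqF.
Qed.

Let jacobi_sqr_neumann_lim C u : l2 C u -> jacobi v (jacobi v (neumann_lim v u)) = K *: u.
Proof.
move=> lu; have cW n := @cvg_neumann C u n lu.
apply/funext => n.
have c1 := @cvg_jacobi _ v _ _ (@cvg_jacobi _ v _ _ cW) n.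
have : (neumann_sum v m.+1 u n @[m --> \oo]) --> neumann_lim v u n.
  by rewrite (@cvg_shiftS _ (fun m => neumann_sum v m u n)).
have -> : (fun m => neumann_sum v m.+1 u n) =
   (fun m => u n + neumann_sum v m u n - K^-1 * jacobi v (jacobi v (neumann_sum v m u)) n).
  by apply/funext => m; rewrite neumann_sumS /neumann !fctE addrA.
have c2 : (u n + neumann_sum v m u n - K^-1 * jacobi v (jacobi v (neumann_sum v m u)) n
    @[m --> \oo]) --> u n + neumann_lim v u n - K^-1 * jacobi v (jacobi v (neumann_lim v u)) n.
  apply: cvgB; first by apply: cvgD => //; exact: cvg_cst.
  by apply: cvgM => //; exact: cvg_cst.
move=> /(cvg_unique _)/(_ c2) => /(_ (@Rhausdorff R)) E.
rewrite fctE; have KK : K * K^-1 = 1 by rewrite divff// gt_eqF.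
have -> : jacobi v (jacobi v (neumann_lim v u)) n =
  K * (K^-1 * jacobi v (jacobi v (neumann_lim v u)) n).
  by rewrite mulrA KK mul1r.
by rewrite /GRing.scale/=; congr (_ * _); lra.
Qed.

Lemma jacobi_resolvent C u : l2 C u -> jacobi v (resolvent v u) = u.
Proof.
move=> lu; rewrite /resolvent (symop_Z (symop_jacobi v)) (jacobi_sqr_neumann_lim lu) scalerA.
by rewrite mulVf ?gt_eqF// scale1r.
Qed.

Let neumann_lim_jacobi C u : l2 C u -> neumann_lim v (jacobi v u) = jacobi v (neumann_lim v u).
Proof.
move=> lu; apply/funext => n; rewrite /neumann_lim; apply: cvg_lim => //.
by under eq_fun do rewrite neumann_sum_jacobi; apply: cvg_jacobi => m; exact: cvg_neumann lu.
Qed.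

Lemma resolvent_jacobi C u : l2 C u -> resolvent v (jacobi v u) = u.
Proof.
move=> lu; rewrite /resolvent (neumann_lim_jacobi lu) (jacobi_sqr_neumann_lim lu) scalerA.
by rewrite mulVf ?gt_eqF// scale1r.
Qed.

Lemma resolventD C C' u w : l2 C u -> l2 C' w ->
  resolvent v (u + w) = resolvent v u + resolvent v w.
Proof.
move=> lu lw; have l := l2D (l2_resolvent lu) (l2_resolvent lw).
by rewrite -[RHS](resolvent_jacobi l) (symop_D (symop_jacobi v)) (jacobi_resolvent lu) (jacobi_resolvent lw).
Qed.

Lemma resolventZ C c u : l2 C u -> resolvent v (c *: u) = c *: resolvent v u.
Proof.
move=> lu; have l := l2Z c (l2_resolvent lu).
by rewrite -[RHS](resolvent_jacobi l) (symop_Z (symop_jacobi v)) (jacobi_resolvent lu).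
Qed.

(** The partial sums are symmetric, and against a finitary vector only finitely
    many coordinates of the limit matter. *)
Lemma resolvent_sym u w : finitary u -> finitary w -> dot (resolvent v u) w = dot u (resolvent v w).
Proof.
move=> fu fw; rewrite /resolvent dotZl dotZr; congr (_ * _).
rewrite dotC -(symop_sym (symop_jacobi v))// dotC.
rewrite -(neumann_lim_jacobi (l2_finitary fw)).
have c1 := cvg_dot (finitary_jacobi v fw) (fun n => @cvg_neumann _ _ n (l2_finitary fu)).
have c2 := cvg_dot fu (fun n => @cvg_neumann _ _ n (l2_finitary (finitary_jacobi v fw))).
have E : (fun m => dot (neumann_sum v m u) (jacobi v w)) =
         (fun m => dot (neumann_sum v m (jacobi v w)) u).
  by apply/funext => m; rewrite [RHS]dotC neumann_sum_sym; auto.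
by rewrite E in c1; rewrite [RHS]dotC; exact: (cvg_unique _ c1 c2).
Qed.

End admissible.
End resolvent.

(** * Green functions and changes at one site *)

Section green_function.
Context {R : realType}.
Variables (M k : R).
Hypothesis k_gt0 : 0 < k.
Implicit Types (u v w : int -> R) (i : int).

Definition admissible v := (forall n, `|v n| <= M) /\ bounded_below k v.

Definition green v i := resolvent M v (delta i) i.

Let rb := @resolvent_bound R M k.

Lemma l2_delta i : l2 (1 : R) (delta i).
Proof. by have := @l2_finitary R _ (finitary_delta i); rewrite dot_deltal /delta eqxx. Qed.

Lemma resolvent_bound_ge0 v : admissible v -> 0 <= rb.
Proof.
move=> [vM lv]; have /l2_ge0 := l2_resolvent vM k_gt0 lv (l2_delta 0).
by rewrite mulr1.
Qed.

Lemma l2_tail C u e : l2 C u -> 0 < e -> exists2 s : seq int, uniq s &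
  forall t, uniq t -> (forall n, n \in t -> n \notin s) -> \sum_(n <- t) u n ^+ 2 <= e.
Proof.
move=> lu e0; pose S := [set x | exists2 s : seq int, uniq s & x = \sum_(n <- s) u n ^+ 2].
have supS : has_sup S.
  by split; [exists 0, [::] => //; rewrite big_nil|exists C => x [s us ->]; exact: lu].
have [x [s us xE] sx] := sup_adherent e0 supS.
exists s => // t ut ts.
have : S (\sum_(n <- s ++ t) u n ^+ 2).
  exists (s ++ t) => //; rewrite cat_uniq us ut andbT/=.
  by apply/hasPn => n; exact: ts.
move=> /(ub_le_sup (proj2 supS)); rewrite big_cat/= -xE; lra.
Qed.

(** With g the Green vector of v, the difference g' - g is the image of
    (v - v') g under the resolvent of v'.  The fixed vector g has a small tail,
    so v - v' has to be small on a finite set only; the norm of the resolvent of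
    v' is controlled uniformly by [resolvent_bound]. *)
Lemma green_continuous v i e : admissible v -> 0 < e ->
  exists (s : seq int) (d : R), 0 < d /\ forall v', admissible v' ->
    (forall n, n \in s -> `|v' n - v n| <= d) -> `|green v' i - green v i| <= e.
Proof.
move=> gv e0; have rb0 := resolvent_bound_ge0 gv; have [vM lv] := gv.
have lg := l2_resolvent vM k_gt0 lv (l2_delta i).
rewrite -/rb mulr1 in lg; set g := resolvent M v (delta i) in lg.
(* a bounds the squared difference of the potentials on s, b the tail of g *)
pose a := e ^+ 2 / (2 * (rb + 1) * (rb + 1)).
have e2 : 0 < e ^+ 2 by rewrite exprn_gt0.
have a0 : 0 < a by rewrite divr_gt0// mulr_gt0 ?mulr_gt0//; lra.
pose b := e ^+ 2 / (2 * (rb + 1) * (4 * M ^+ 2 + 1)).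
have b0 : 0 < b by rewrite divr_gt0// mulr_gt0 ?mulr_gt0//; have := sqr_ge0 M; lra.
have [s us hs] := l2_tail lg b0.
exists s, (Num.sqrt a); split=> [|v' gv' vv']; first by rewrite sqrtr_gt0.
have [vM' lv'] := gv'.
have lg' := l2_resolvent vM' k_gt0 lv' (l2_delta i).
pose h : int -> R := fun n => (v n - v' n) * g n.
have lh : l2 (a * rb + 4 * M ^+ 2 * b) h.
  move=> t ut; rewrite (bigID (mem s))/=; apply: lerD.
    rewrite -big_filter; apply: (@le_trans _ _
      (a * \sum_(n <- [seq n <- t | n \in s]) g n ^+ 2)).
      rewrite mulr_sumr big_seq [leRHS]big_seq; apply: ler_sum => n.
      rewrite mem_filter => /andP[ns _]; rewrite exprMn ler_wpM2r ?sqr_ge0//.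
      rewrite -(sqr_sqrtr (ltW a0)) -[X in X <= _]real_normK ?num_real//.
      by rewrite ler_pXn2r ?nnegrE ?sqrtr_ge0// distrC vv'.
    by rewrite ler_pM2l// lg// filter_uniq.
  rewrite -big_filter; apply: (@le_trans _ _
    (4 * M ^+ 2 * \sum_(n <- [seq n <- t | n \notin s]) g n ^+ 2)).
    rewrite mulr_sumr; apply: ler_sum => n _; rewrite exprMn ler_wpM2r ?sqr_ge0//.
    have := vM n; have := vM' n; rewrite !ler_norml => /andP[? ?] /andP[? ?].
    have -> : 4 * M ^+ 2 = (2 * M) ^+ 2 by ring.
    by rewrite -[X in X <= _]real_normK ?num_real// ler_pXn2r ?nnegrE// ?ler_norml; lra.
  apply: ler_wpM2l; first by rewrite mulr_ge0 ?sqr_ge0.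
  apply: hs => [|n]; first exact: filter_uniq.
  by rewrite mem_filter => /andP[].
set g' := resolvent M v' (delta i) in lg'.
have gg : g' - g = resolvent M v' h.
  have lgg : l2 (2 * (rb * 1) + 2 * ((-1) ^+ 2 * rb)) (g' - g).
    by have := l2D lg' (l2Z (-1) lg); rewrite scaleN1r.
  rewrite -[LHS](resolvent_jacobi vM' k_gt0 lv' lgg); congr resolvent.
  apply/funext => n.
  have := congr1 (fun w => w n) (jacobi_resolvent vM k_gt0 lv (l2_delta i)).
  have := congr1 (fun w => w n) (jacobi_resolvent vM' k_gt0 lv' (l2_delta i)).
  rewrite -/g -/g' /jacobi /h !fctE; lra.
have := l2_at i (l2_resolvent vM' k_gt0 lv' lh); rewrite -gg -/rb => ge.
rewrite -(@ler_pXn2r _ 2) ?nnegrE ?(ltW e0)// real_normK ?num_real//.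
apply: le_trans ge _.
have r1 : 0 < rb + 1 by lra.
have m1 : 0 < 4 * M ^+ 2 + 1 by have := sqr_ge0 M; lra.
have -> : a * rb = e ^+ 2 / (2 * (rb + 1)) * (rb / (rb + 1)) by rewrite /a; field; lra.
have -> : 4 * M ^+ 2 * b = e ^+ 2 / (2 * (rb + 1)) * (4 * M ^+ 2 / (4 * M ^+ 2 + 1)).
  by rewrite /b; field; rewrite (gt_eqF r1) (gt_eqF m1).
rewrite -mulrDr.
have x1 : rb / (rb + 1) <= 1 by rewrite ler_pdivrMr//; lra.
have x2 : 4 * M ^+ 2 / (4 * M ^+ 2 + 1) <= 1 by rewrite ler_pdivrMr//; lra.
have -> : rb * (e ^+ 2 / (2 * (rb + 1)) * (rb / (rb + 1) + 4 * M ^+ 2 / (4 * M ^+ 2 + 1))) =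
  e ^+ 2 * ((rb / (rb + 1)) * ((rb / (rb + 1) + 4 * M ^+ 2 / (4 * M ^+ 2 + 1)) / 2)).
  by field; rewrite (gt_eqF r1) (gt_eqF m1).
have x0 : 0 <= rb / (rb + 1) by rewrite divr_ge0// ltW.
have x3 : 0 <= 4 * M ^+ 2 / (4 * M ^+ 2 + 1) by apply: divr_ge0; [rewrite mulr_ge0 ?sqr_ge0|exact: ltW].
rewrite ler_piMr ?sqr_ge0//.
by apply: mulr_ile1 => //; lra.
Qed.

Lemma l2_translate C j u : l2 C u -> l2 C (translate j u).
Proof.
move=> lu s us; have := lu [seq n + j | n <- s].
rewrite big_map; apply; rewrite map_inj_uniq// => m n; exact: addIr.
Qed.

Lemma jacobi_translate j v u : jacobi (translate j v) (translate j u) = translate j (jacobi v u).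
Proof.
by apply/funext => n; rewrite /jacobi /translate; congr (u _ + u _ + _); ring.
Qed.

Lemma admissible_translate j v : admissible v -> admissible (translate j v).
Proof.
move=> [vM lv]; split=> [n|u fu]; first exact: vM.
have -> : u = translate j (translate (- j) u).
  by apply/funext => n; rewrite /translate addrK.
rewrite jacobi_translate (dot_translate j (translate (- j) u)) (dot_translate j (jacobi v _)).
by apply: lv; exact: finitary_translate.
Qed.

Lemma green_translate j v i : admissible v -> green (translate j v) i = green v (i + j).
Proof.
move=> gv; have [vM lv] := gv; have [vM' lv'] := admissible_translate j gv.
rewrite /green.
have lg := l2_translate j (l2_resolvent vM k_gt0 lv (l2_delta (i + j))).
have -> : delta i = translate j (delta (i + j)) :> (int -> R).
  by apply/funext => n; rewrite /translate /delta (inj_eq (addIr j)).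
rewrite -[in LHS](jacobi_resolvent vM k_gt0 lv (l2_delta (i + j))) -jacobi_translate.
by rewrite (resolvent_jacobi vM' k_gt0 lv' lg).
Qed.

Section rank_one.
Variables (v : int -> R) (c : R) (i : int).
Let v' := v + c *: delta i.
Hypotheses (gv : admissible v) (gv' : admissible v').

Let step u : finitary u ->
  resolvent M v u = resolvent M v' u + (c * resolvent M v' u i) *: resolvent M v (delta i).
Proof.
move=> fu; have [vM lv] := gv; have [vM' lv'] := gv'; have lu := l2_finitary fu.
have lz := l2_resolvent vM' k_gt0 lv' lu; set z := resolvent M v' u in lz *.
have jacobi_z : jacobi v z = u + (- (c * z i)) *: delta i.
  rewrite -[u in RHS](jacobi_resolvent vM' k_gt0 lv' lu) -/z.
  apply/funext => n; rewrite /jacobi /v' !fctE /GRing.scale/= /delta.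
  by case: eqVneq => [->|_]; rewrite ?mulr1n ?mulr0n/=; ring.
have := resolvent_jacobi vM k_gt0 lv lz; rewrite jacobi_z.
rewrite (resolventD vM k_gt0 lv lu (l2Z _ (l2_delta i))).
rewrite (resolventZ vM k_gt0 lv _ (l2_delta i)) => E.
rewrite -[X in _ = X + _]E.
by rewrite scaleNr subrK.
Qed.

(** The factor 1 + c G(i, i) is invertible because the perturbed operator is:
    its inverse is 1 - c G'(i, i). *)
Lemma rank_one_neq0 : 1 + c * green v i != 0.
Proof.
have := congr1 (fun w => w i) (step (finitary_delta i)); rewrite !fctE -/(green v i).
set y := resolvent M v' (delta i) i => E; apply/eqP => a0.
have : green v i = y * (1 + c * green v i) by rewrite {1}E /GRing.scale/=; ring.
by rewrite a0 mulr0 => g0; move: a0; rewrite g0 mulr0 addr0 => /eqP; rewrite oner_eq0.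
Qed.

(** The resolvent identity for a potential changed at the site [i]; the sign of
    the difference of the two forms is that of c (1 + c G(i, i)). *)
Lemma rank_one u : finitary u -> dot (resolvent M v u) u - dot (resolvent M v' u) u =
  c * (1 + c * green v i) * resolvent M v' u i ^+ 2.
Proof.
move=> fu; have [vM lv] := gv.
have sE := step fu.
have gu : dot (resolvent M v (delta i)) u = resolvent M v u i.
  by rewrite (resolvent_sym vM k_gt0 lv (finitary_delta i) fu) dot_deltal.
rewrite [in LHS]dotC {1}sE dot_finitaryDr// dotZr [dot u (resolvent M v (delta i))]dotC gu.
rewrite dotC sE !fctE -/(green v i) /GRing.scale/=; ring.
Qed.

End rank_one.

Lemma resolvent_sum v (r : nat) (c : 'I_r -> R) (z : 'I_r -> int -> R) :
  admissible v -> (forall j, finitary (z j)) ->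
  resolvent M v (\sum_j c j *: z j) = \sum_j c j *: resolvent M v (z j).
Proof.
move=> [vM lv] fz; have lz j := l2_finitary (fz j).
suff : finitary (\sum_j c j *: z j) /\
  resolvent M v (\sum_j c j *: z j) = \sum_j c j *: resolvent M v (z j) by case.
elim/big_ind2 : _ => [|u u' w w' [fu <-] [fw <-]|j _].
- split; first exact: finitary0.
  by rewrite -[X in resolvent M v X](scale0r (delta 0))
    (resolventZ vM k_gt0 lv _ (l2_delta 0)) scale0r.
- by split; [exact: finitaryD|
    rewrite (resolventD vM k_gt0 lv (l2_finitary fu) (l2_finitary fw))].
- by split; [exact/finitaryZ|rewrite (resolventZ vM k_gt0 lv _ (lz j))].
Qed.

Lemma dot_l2_CS C z w : finitary w -> l2 C z -> dot z w ^+ 2 <= C * dot w w.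
Proof.
move=> /[dup] fw [s h] lz.
have -> : dot z w = dot (cutoff s z) w.
  apply: eq_fsbigr => n _; rewrite /cutoff; case: (boolP (n \in s)) => ns.
    by rewrite mul1r.
  by rewrite h// !mulr0.
apply: le_trans (dot_CS (finitary_cutoff s z) fw) _.
by rewrite ler_wpM2r ?dot_ge0// dot_cutoff.
Qed.

End green_function.

Lemma dot_pythagoras (R : realType) (r : nat) (c : 'I_r -> R) (z : 'I_r -> int -> R) :
  (forall j, finitary (z j)) -> (forall i j, i != j -> dot (z i) (z j) = 0) ->
  dot (\sum_j c j *: z j) (\sum_j c j *: z j) = \sum_j c j ^+ 2 * dot (z j) (z j).
Proof.
move=> fz orth.
have dl (F : 'I_r -> int -> R) w : (forall j, finitary (F j)) ->
    dot (\sum_j F j) w = \sum_j dot (F j) w.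
  move=> fF; suff : finitary (\sum_j F j) /\ dot (\sum_j F j) w = \sum_j dot (F j) w by case.
  elim/big_ind2 : _ => [|u a u' a' [fu <-] [fu' <-]|j _].
    by split; [exact: finitary0|exact: dot0l].
    by split; [exact: finitaryD|exact: dotDl].
  by [].
rewrite dl; last by move=> j; exact: finitaryZ.
apply: eq_bigr => j _; rewrite dotZl dotC dl; last by move=> i; exact: finitaryZ.
rewrite (bigD1 j)//= big1 ?addr0; first by rewrite dotZl expr2 mulrA.
by move=> i ij; rewrite dotZl orth// mulr0.
Qed.

Lemma left_kernel (F : fieldType) (r : nat) (A : 'M[F]_(r.+1, r)) :
  exists c : 'I_r.+1 -> F, (exists i, c i != 0) /\ forall j, \sum_i c i * A i j = 0.
Proof.
have : kermx A != 0.
  rewrite kermx_eq0 /row_free neq_ltn ltnS.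
  by rewrite rank_leq_col.
case/matrix0Pn => a [b ab]; exists (fun i => kermx A a i); split; first by exists b.
move=> j; have /matrixP/(_ a j) := mulmx_ker A.
by rewrite !mxE.
Qed.

(** * The dichotomy for a recurrent connected family *)

Lemma near_in_seq (X : topologicalType) (x : X) (I : eqType) (s : seq I)
    (Q : I -> X -> Prop) :
  (forall i, \forall y \near x, Q i y) -> \forall y \near x, forall i, i \in s -> Q i y.
Proof.
move=> h; elim: s => [|i s IH]; first by near=> y => i; rewrite in_nil.
near=> y => j; rewrite inE => /orP[/eqP->|js]; first by near: y; exact: h.
by move: j js; near: y.
Unshelve. all: by end_near. Qed.

(** Up to a small error f = D / p and f' = D / p'; since p < p', which of the two
    is larger tells whether p and p' have the same sign. *)
Lemma reciprocal_comparison (R : realFieldType) (p p' D f f' th : R) :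
  p != 0 -> p' != 0 -> p < p' -> 0 < D -> th = (p' - p) / (2 * (`|p| + `|p'|)) ->
  `|D - p * f| <= th * D -> `|D - p' * f'| <= th * D ->
  (f' <= f -> 0 < p * p') /\ (f <= f' -> p * p' < 0).
Proof.
move=> p0 p'0 pp D0 thE; rewrite !ler_norml => /andP[h1 h2] /andP[h3 h4].
have S0 : 0 < `|p| + `|p'| by rewrite addr_gt0// normr_gt0.
have thS : th * (`|p| + `|p'|) = (p' - p) / 2 by rewrite thE; field; rewrite gt_eqF.
have th2 : th <= 1 / 2.
  rewrite -(ler_pM2r S0) thS.
  by have := ler_norm p'; have := ler_norm (- p); rewrite normrN; lra.
have th0 : 0 < th by rewrite thE divr_gt0 ?mulr_gt0// subr_gt0.
have thD : th * D <= D / 2 by rewrite mulrC; nra.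
have [pn|pp0|] := ltgtP p 0; last by move=> pE; rewrite pE eqxx in p0.
- have [p'n|p'p|] := ltgtP p' 0; last by move=> pE; rewrite pE eqxx in p'0.
  + split=> [_|ff]; first by rewrite nmulr_rgt0.
    exfalso; move: thS; rewrite !ltr0_norm// => thS.
    have e1 : p' * (D + th * D) <= p' * (p * f) by rewrite ler_nM2l//; lra.
    have e2 : p * (p' * f') <= p * (D - th * D) by rewrite ler_nM2l//; lra.
    have e3 : p * p' * f <= p * p' * f' by rewrite ler_wpM2l// ltW// nmulr_rgt0.
    have : (p' - p) * D <= (p' - p) / 2 * D by rewrite -thS; lra.
    by rewrite ler_pM2r//; lra.
  + split=> [ff|_]; last by rewrite nmulr_rlt0.
    have f0 : f < 0 by rewrite -(nmulr_rgt0 _ pn); lra.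
    have f'0 : 0 < f' by rewrite -(pmulr_rgt0 _ p'p); lra.
    lra.
- have p'p : 0 < p' by lra.
  split=> [_|ff]; first by rewrite mulr_gt0.
  exfalso; move: thS; rewrite !gtr0_norm// => thS.
  have e1 : p' * (D - th * D) <= p' * (p * f) by rewrite ler_pM2l//; lra.
  have e2 : p * (p' * f') <= p * (D + th * D) by rewrite ler_pM2l//; lra.
  have e3 : p * p' * f <= p * p' * f' by rewrite ler_wpM2l// ltW// mulr_gt0.
  have : (p' - p) * D <= (p' - p) / 2 * D by rewrite -thS; lra.
  by rewrite ler_pM2r//; lra.
Qed.

Section dichotomy.
Context {R : realType} {X : topologicalType}.
Variables (F : X -> int -> R) (tau : X -> X).
Hypothesis X_connected : connected [set: X].
Hypothesis F_continuous : forall n, continuous (F^~ n).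
Hypothesis tau_continuous : continuous tau.
Hypothesis F_tau : forall x n, F x (n + 1) = F (tau x) n.
Hypothesis recurrent : forall (U : set X) (N : nat), open U -> U !=set0 ->
  exists2 k, (N <= k)%N & exists2 x, U x & U (iter k tau x).

Let F_iter x n k : F x (n + k%:Z) = F (iter k tau x) n.
Proof.
elim: k n x => [|k IH] n x; first by rewrite addr0.
by rewrite iterSr -IH -F_tau -addn1 PoszD addrA.
Qed.

Let iter_continuous k : continuous (iter k tau).
Proof.
elim: k => [|k IH]; first by move=> x; exact: cvg_id.
by move=> x /=; apply: continuous_comp; [exact: IH|exact: tau_continuous].
Qed.

Let spaced (N a b : nat) := (a + N <= b)%N.

(** If U meets its preimage at time k in W, then r + 1 visits to W, followed by
    the last one delayed by k, are r + 2 visits to U. *)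
Lemma multiple_recurrence (U : set X) N r : open U -> U !=set0 ->
  exists x ks, [/\ size ks = r.+1, path (spaced N) 0%N ks &
    forall k, k \in ks -> U (iter k tau x)].
Proof.
elim: r U => [|r IH] U oU U0.
  have [k Nk [x _ Ux]] := recurrent N oU U0.
  by exists x, [:: k]; split=> //=; [rewrite /spaced Nk|move=> k'; rewrite inE => /eqP->].
have [k Nk [x Ux Uk]] := recurrent N oU U0.
pose W := U `&` (iter k tau @^-1` U).
have oW : open W.
  by apply: openI => //; apply: open_comp => // y _; exact: iter_continuous.
have [|y [ks [sks pks Wks]]] := IH W oW; first by exists x.
exists y, (rcons ks (k + last 0%N ks)); split.
- by rewrite size_rcons sks.
- by rewrite rcons_path pks /spaced addnC leq_add2r.
- move=> j; rewrite mem_rcons inE => /orP[/eqP->|/Wks[]//].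
  rewrite iterD; suff /Wks[] : last 0%N ks \in ks by [].
  by case: ks sks {pks Wks} => // a l _; exact: mem_last.
Qed.

Variables (M k s t : R).
Hypothesis k_gt0 : 0 < k.
Hypothesis st : s < t.

Definition mixture x (b : int -> bool) : int -> R :=
  fun n => F x n + (if b n then t else s).

Hypothesis mixture_admissible : forall x b, admissible M k (mixture x b).

Let lam := t - s.
Let lam_gt0 : 0 < lam. Proof. by rewrite subr_gt0. Qed.

Let flip (b : int -> bool) (i : int) : int -> bool := fun n => (n == i) || b n.

Let mixture_flip x b i : b i = false -> mixture x (flip b i) = mixture x b + lam *: delta i.
Proof.
move=> bi; apply/funext => n; rewrite /mixture /flip /delta !fctE /GRing.scale/=.
case: eqVneq => [->|_]/=; first by rewrite bi /lam; ring.
by rewrite mulr0 addr0.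
Qed.

(** By the rank one formula this is negative exactly when an eigenvalue crosses
    zero while the potential at [i] moves from [s] to [t]. *)
Definition coupling x b i := 1 + lam * green M (mixture x b) i.

Let coupling_neq0 x b i : b i = false -> coupling x b i != 0.
Proof.
move=> bi; apply: (rank_one_neq0 k_gt0 (mixture_admissible x b)).
by rewrite -mixture_flip.
Qed.

Let coupling_continuous b i : continuous (fun x => coupling x b i).
Proof.
move=> x; apply/cvgrPdist_le => /= e e0.
have [r [d [d0 h]]] := green_continuous k_gt0 i
  (mixture_admissible x b) (divr_gt0 e0 lam_gt0).
have : \forall y \near x, forall n, n \in r -> `|F x n - F y n| <= d.
  apply: near_in_seq => n.
  by have /cvgrPdist_le := @F_continuous n x; apply.
apply: filterS => y hy; rewrite /coupling.
have -> : forall z z' : R, 1 + lam * z - (1 + lam * z') = lam * (z - z') by move=> *; ring.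
rewrite normrM gtr0_norm// -ler_pdivlMl// mulrC distrC; apply: h => // n nr.
have -> : mixture y b n - mixture x b n = F y n - F x n by rewrite /mixture; ring.
by rewrite distrC; exact: hy.
Qed.

(** A continuous function without zeros on a connected space has a sign. *)
Lemma coupling_sign x y b i : b i = false -> (0 < coupling x b i) = (0 < coupling y b i).
Proof.
move=> bi; suff H x' y' : 0 < coupling x' b i -> 0 < coupling y' b i.
  by apply/idP/idP; exact: H.
move=> gx; rewrite lt_neqAle eq_sym coupling_neq0//= leNgt; apply/negP => gy.
have : connected ((fun x => coupling x b i) @` [set: X]).
  by apply: connected_continuous_connected => //;
    apply: continuous_subspaceT; exact: coupling_continuous.
move/connected_intervalP => itv.
have [z _ /eqP] : ((fun x => coupling x b i) @` [set: X]) 0.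
  apply: (itv (coupling y' b i) (coupling x' b i)); [by exists y'|by exists x'|].
  by rewrite (ltW gx) (ltW gy).
by apply/negP; exact: coupling_neq0.
Qed.

Let block (j : nat) : int -> bool := fun n => (0 < n) && (n <= j%:Z).

Let block_S j : block j.+1 = flip (block j) j.+1%:Z.
Proof. by apply/funext => n; rewrite /block /flip; lia. Qed.

Let block_out j : block j j.+1%:Z = false.
Proof. by rewrite /block; lia. Qed.

(** As seen from the site j + 1, moved to 1, the block of t on 1, ..., j becomes
    the block 1 - j, ..., 0.  The base point moves too, which does not affect the
    sign by [coupling_sign]; and the blocks converge to a half-line, for which
    the coupling is nonzero as well. *)
Lemma coupling_sign_eventually : [set: X] !=set0 -> exists (pos : bool) (N0 : nat),
  forall j x, (N0 <= j)%N -> (0 < coupling x (block j) j.+1%:Z) = pos.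
Proof.
move=> [x0 _]; pose b : int -> bool := fun n => n <= 0.
pose a := coupling x0 b 1.
have a0 : a != 0 by exact: coupling_neq0.
have e0 : 0 < `|a| / 2 / lam by rewrite !divr_gt0 ?normr_gt0.
have [r [d [d0 h]]] := green_continuous k_gt0 1 (mixture_admissible x0 b) e0.
exists (0 < a), (\max_(n <- r) absz n).+1 => j x Jj.
pose c : int -> bool := fun n => block j (n + j%:Z).
have -> : coupling x (block j) j.+1%:Z = coupling (iter j tau x) c 1.
  rewrite /coupling; congr (1 + _ * _).
  have -> : mixture (iter j tau x) c = translate j%:Z (mixture x (block j)).
    by apply/funext => n; rewrite /mixture /translate F_iter.
  by rewrite (green_translate k_gt0)// -PoszD.
have c1 : c 1 = false by rewrite /c -PoszD add1n block_out.
rewrite (coupling_sign _ x0)//.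
have near : `|coupling x0 c 1 - a| <= `|a| / 2.
  rewrite /a /coupling.
  have -> : forall z z' : R, 1 + lam * z - (1 + lam * z') = lam * (z - z') by move=> *; ring.
  rewrite normrM gtr0_norm// -ler_pdivlMl// mulrC; apply: h => // n nr.
  have -> : mixture x0 c n = mixture x0 b n.
    have nj : (absz n < j)%N.
      by apply: leq_ltn_trans Jj; exact: (@leq_bigmax_seq _ r predT absz n).
    have cb : c n = b n by rewrite /c /b /block; lia.
    by rewrite /mixture cb.
  by rewrite subrr normr0 ltW.
move: near a0; move: (coupling x0 c 1) => z; rewrite ler_norml neq_lt.
by case: (ltgtP 0 a) => // ha; [rewrite gtr0_norm//|rewrite ltr0_norm//];
  move=> /andP[? ?] _; [apply/idP|apply/negbTE; rewrite -leNgt]; lra.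
Qed.

(** The rank one formula, summed over the sites of a block. *)
Lemma block_telescope x u n : finitary u ->
  dot (resolvent M (mixture x (block 0)) u) u - dot (resolvent M (mixture x (block n)) u) u =
  \sum_(0 <= j < n) lam * coupling x (block j) j.+1%:Z *
    resolvent M (mixture x (block j.+1)) u j.+1%:Z ^+ 2.
Proof.
move=> fu; elim: n => [|n IH]; first by rewrite subrr big_nil.
rewrite big_nat_recr//= -IH.
have := rank_one k_gt0 (c := lam) (i := n.+1%:Z) (mixture_admissible x (block n)) _ fu.
rewrite -mixture_flip// -block_S => /(_ (mixture_admissible x _)) E.
by rewrite /coupling -E addrA subrK.
Qed.

(** The point [x] may depend on [eps]: Weyl sequences along the whole family
    describe the closure of the union of all its spectra. *)
Definition approx_eigenvalue e := forall eps, 0 < eps -> exists x u, finitary u /\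
  dot (jacobi (shift_energy (F x) e) u) (jacobi (shift_energy (F x) e) u) < eps * dot u u.

(** On the support of u the mixture is the constant c, so that u is almost an
    eigenvector of the mixture, and of its inverse, whatever the mixture does
    elsewhere. *)
Lemma resolvent_at_approx x b u e c eta : finitary u ->
  (forall n, u n != 0 -> b n = c) ->
  let r := jacobi (shift_energy (F x) e) u in
  resolvent_bound M k * dot r r <= eta * dot u u ->
  (dot u u - (e + (if c then t else s)) * dot (resolvent M (mixture x b) u) u) ^+ 2
    <= eta * dot u u ^+ 2.
Proof.
move=> fu bc r hr; have [vM lv] := mixture_admissible x b.
set p := e + _.
have fr : finitary r by exact: finitary_jacobi.
have jacobi_u : jacobi (mixture x b) u = p *: u + r.
  apply/funext => n; rewrite /jacobi /mixture /r /jacobi /shift_energy /p !fctE /GRing.scale/=.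
  have [->|un] := eqVneq (u n) 0; first by ring.
  by rewrite bc//; ring.
have := resolvent_jacobi vM k_gt0 lv (l2_finitary fu); rewrite jacobi_u.
rewrite (resolventD vM k_gt0 lv (l2_finitary (finitaryZ p fu)) (l2_finitary fr)).
rewrite (resolventZ vM k_gt0 lv _ (l2_finitary fu)) => uE.
have -> : dot u u - p * dot (resolvent M (mixture x b) u) u = dot (resolvent M (mixture x b) r) u.
  have := congr1 (dot u) uE; rewrite dot_finitaryDr// dotZr.
  rewrite (dotC u (resolvent M (mixture x b) u)) (dotC u (resolvent M (mixture x b) r)).
  by move=> <-; ring.
apply: le_trans (dot_l2_CS fu (l2_resolvent vM k_gt0 lv (l2_finitary fr))) _.
by rewrite expr2 mulrA ler_wpM2r ?dot_ge0.
Qed.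


Lemma finitary_bound (u : int -> R) : finitary u ->
  exists L : nat, forall n, u n != 0 -> (absz n <= L)%N.
Proof.
case=> r h; exists (\max_(n <- r) absz n) => n un.
apply: (@leq_bigmax_seq _ r predT absz n) => //.
by apply: contraNT un => nr; rewrite h.
Qed.

Let packet_support (u : int -> R) (L j : nat) n : (forall n, u n != 0 -> (absz n <= L)%N) ->
  translate (- j%:Z) u n != 0 -> (j%:Z - L%:Z <= n <= j%:Z + L%:Z).
Proof. by move=> uL /uL; lia. Qed.

Let jacobi_support (v u : int -> R) (L : nat) n : (forall n, u n != 0 -> (absz n <= L)%N) ->
  jacobi v u n != 0 -> (absz n <= L.+1)%N.
Proof.
move=> uL; rewrite -ltnS; apply: contraNT => nL.
have u0 m : (L < absz m)%N -> u m = 0.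
  by move=> Lm; apply/eqP; apply: contraLR Lm; rewrite -leqNgt; exact: uL.
by rewrite /jacobi !u0 ?mulr0 ?addr0//; lia.
Qed.

(** Approximate eigenvectors for the points of an orbit are found at the times
    when the orbit visits the open set of points where a given vector is a good
    one.  With one packet more than there are conditions, some nonzero
    combination satisfies the N0 linear conditions at the first sites. *)
Lemma packets e eps N0 : approx_eigenvalue e -> 0 < eps -> exists x n w,
  [/\ finitary w, 0 < dot w w, forall m, w m != 0 -> 0 < m <= n%:Z,
     let r := jacobi (shift_energy (F x) e) w in dot r r <= eps * dot w w &
     (N0 <= n)%N /\ forall j, (j < N0)%N ->
       resolvent M (mixture x (block j.+1)) w j.+1%:Z = 0].
Proof.
move=> ae eps0; have [y [u [fu uy]]] := ae _ eps0.
have u0 : 0 < dot u u by rewrite -(pmulr_rgt0 _ eps0); exact: le_lt_trans (dot_ge0 _) uy.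
have [L uL] := finitary_bound fu.
pose g x := dot (jacobi (shift_energy (F x) e) u) (jacobi (shift_energy (F x) e) u).
pose U := [set x | g x < eps * dot u u].
have cg : continuous g.
  have [a [b ab]] : exists (r : seq int) (b : unit), uniq r /\
     forall x n, n \notin r -> jacobi (shift_energy (F x) e) u n = 0.
    exists [seq (i%:Z - L.+1%:Z) | i <- iota 0 (2 * L.+2)], tt; split.
      by rewrite map_inj_uniq ?iota_uniq// => i j /addIr[].
    move=> x n nr; apply/eqP; apply: contraNT nr => /(jacobi_support uL) nL.
    apply/mapP; exists (absz (n + L.+1%:Z)); last by lia.
    by rewrite mem_iota; lia.
  case: ab => ua ha.
  have -> : g = fun x => \sum_(n <- a)
      jacobi (shift_energy (F x) e) u n * jacobi (shift_energy (F x) e) u n.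
    by apply/funext => x; rewrite /g (@dotE _ a)// => n na; rewrite ha// mul0r.
  have cont_jacobi n : continuous (fun x => jacobi (shift_energy (F x) e) u n).
    move=> x; rewrite /jacobi /shift_energy; apply: cvgD; first exact: cvg_cst.
    apply: cvgM; last exact: cvg_cst.
    by apply: cvgB; [exact: F_continuous|exact: cvg_cst].
  by apply: continuous_big => [|n _ x]; [exact: add_continuous|apply: cvgM; exact: cont_jacobi].
have oU : open U.
  have -> : U = g @^-1` [set z | z < eps * dot u u] by [].
  by apply: open_comp => [x _|]; [exact: cg|exact: open_lt].
(* this spacing makes the images of the packets disjoint too: they are
   supported within distance L + 1 of the visiting times *)
have [x [ks [sks pks Uks]]] := multiple_recurrence (2 * L + 3) N0 oU (ex_intro _ y uy).
pose kk (i : 'I_N0.+1) := nth 0%N ks i.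
have kkin i : kk i \in ks by rewrite mem_nth// sks.
have sp_trans : transitive (spaced (2 * L + 3)) by move=> a b c; rewrite /spaced; lia.
have kkN i : (2 * L + 3 <= kk i)%N.
  by have /allP/(_ _ (kkin i)) := order_path_min sp_trans pks.
have kklt (i j : 'I_N0.+1) : (i < j)%N -> (kk i + (2 * L + 3) <= kk j)%N.
  move=> ij; apply: (sorted_ltn_nth sp_trans 0%N (path_sorted pks)) => //;
    by rewrite inE sks.
have kkdiff (i j : 'I_N0.+1) : i != j ->
    (kk i + (2 * L + 3) <= kk j)%N || (kk j + (2 * L + 3) <= kk i)%N.
  by rewrite neq_ltn => /orP[/kklt->//|/kklt->]; rewrite orbT.
pose z i := translate (- (kk i)%:Z) u.
have fz i : finitary (z i) by exact: finitary_translate.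
pose r i := jacobi (shift_energy (F x) e) (z i).
have rE i : r i =
    translate (- (kk i)%:Z) (jacobi (shift_energy (F (iter (kk i) tau x)) e) u).
  rewrite -jacobi_translate /r; congr jacobi; apply/funext => n.
  by rewrite /translate /shift_energy -F_iter subrK.
have fr i : finitary (r i) by exact: finitary_jacobi.
have oz i j : i != j -> dot (z i) (z j) = 0.
  move=> /kkdiff ij; apply: fsbig1 => n _; apply/eqP; rewrite mulf_eq0.
  apply/negPn; rewrite negb_or; apply/negP => /andP[].
  by move=> /(packet_support uL) h1 /(packet_support uL) h2; lia.
have or i j : i != j -> dot (r i) (r j) = 0.
  move=> /kkdiff ij; apply: fsbig1 => n _; apply/eqP; rewrite mulf_eq0 !rE.
  apply/negPn; rewrite negb_or; apply/negP => /andP[].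
  move=> /(packet_support (fun n => @jacobi_support _ _ _ n uL)) h1.
  by move=> /(packet_support (fun n => @jacobi_support _ _ _ n uL)) h2; lia.
pose A := \matrix_(i < N0.+1, j < N0) resolvent M (mixture x (block j.+1)) (z i) j.+1%:Z.
have [c [[i0 ci0] cA]] := left_kernel A.
pose w := \sum_i c i *: z i.
have wE n : w n = \sum_i c i * z i n by rewrite /w fct_sumE.
have fw : finitary w by apply: finitary_sum => i; exact: finitaryZ.
have dw : dot w w = \sum_i c i ^+ 2 * dot u u.
  by rewrite /w dot_pythagoras//; apply: eq_bigr => i _; rewrite dot_translate.
have jacobi_w : jacobi (shift_energy (F x) e) w = \sum_i c i *: r i.
  rewrite /w; elim/big_ind2 : _ => [|a a' b b' <- <-|i _].
  - by rewrite -[X in jacobi _ X](scale0r u) (symop_Z (symop_jacobi _)) scale0r.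
  - by rewrite (symop_D (symop_jacobi _)).
  - by rewrite (symop_Z (symop_jacobi _)).
exists x, (last 0%N ks + L + N0)%N, w; split => //.
- rewrite dw (bigD1 i0)//= ltr_pwDl//; first by rewrite mulr_gt0// exprn_even_gt0.
  by apply: sumr_ge0 => i _; rewrite mulr_ge0 ?sqr_ge0// ltW.
- move=> m; rewrite wE => wm.
  have [i zi] : exists i, z i m != 0.
    apply/existsP; apply: contraNT wm; rewrite negb_exists => /forallP h.
    by rewrite big1// => i _; move: (h i); rewrite negbK => /eqP->; rewrite mulr0.
  have := packet_support uL zi; have := kkN i.
  have : (kk i <= last 0%N ks)%N.
    rewrite (last_nth 0%N) -/(nth 0%N (0%N :: ks) _) sks/=.
    have [->//|iJ] := eqVneq i ord_max.
    apply: leq_trans (kklt i ord_max _); first by rewrite leq_addr.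
    by rewrite ltn_neqAle iJ/= -ltnS.
  by clear; move=> *; lia.
- rewrite /= jacobi_w dot_pythagoras// dw mulr_sumr; apply: ler_sum => i _.
  rewrite mulrCA ler_wpM2l ?sqr_ge0// rE dot_translate ltW//.
  exact: Uks (kkin i).
- split=> [|j jJ]; first by rewrite leq_addl.
  rewrite (resolvent_sum k_gt0 _ (mixture_admissible x _) fz) fct_sumE.
  by rewrite -[RHS](cA (Ordinal jJ)); apply: eq_bigr => i _; rewrite mxE.
Qed.

Lemma approx_eigenvalue_neq e (c : bool) : approx_eigenvalue e ->
  e + (if c then t else s) != 0.
Proof.
move=> ae; apply/eqP => e0; have [x [u [fu]]] := ae _ k_gt0.
have [_ /(_ u fu)] := mixture_admissible x (fun=> c).
have -> : mixture x (fun=> c) = shift_energy (F x) e.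
  by apply/funext => n; rewrite /mixture /shift_energy; congr (_ + _); lra.
by move=> /le_lt_trans h /h; rewrite ltxx.
Qed.

(** In the telescoping sum for a packet that is blind to the first N0 sites all
    terms have the sign of the eventual coupling, which compares the forms of
    the inverses for the constant potentials s and t. *)
Lemma approx_eigenvalue_sign (pos : bool) (N0 : nat) e :
  (forall j x, (N0 <= j)%N -> (0 < coupling x (block j) j.+1%:Z) = pos) ->
  approx_eigenvalue e ->
  if pos then 0 < (e + s) * (e + t) else (e + s) * (e + t) < 0.
Proof.
move=> hJ ae.
have p0 : e + s != 0 := approx_eigenvalue_neq false ae.
have p'0 : e + t != 0 := approx_eigenvalue_neq true ae.
have pp : e + s < e + t by rewrite ltrD2l.
set p := e + s in p0 pp *; set p' := e + t in p'0 pp *.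
pose th := (p' - p) / (2 * (`|p| + `|p'|)).
have th0 : 0 < th by rewrite divr_gt0 ?subr_gt0// mulr_gt0// addr_gt0// normr_gt0.
have [xe _] := ae 1 ltr01.
pose rb := @resolvent_bound R M k.
have rb0 : 0 <= rb := resolvent_bound_ge0 k_gt0 (mixture_admissible xe (fun=> true)).
have rb1 : 0 < rb + 1 by lra.
have eps0 : 0 < th ^+ 2 / (rb + 1) by rewrite divr_gt0// exprn_gt0.
have [x [n [w [fw w0 ws rw [nJ wJ]]]]] := packets N0 ae eps0.
have {}rw : rb * dot (jacobi (shift_energy (F x) e) w) (jacobi (shift_energy (F x) e) w)
    <= th ^+ 2 * dot w w.
  apply: le_trans (ler_wpM2l rb0 rw) _; rewrite mulrA ler_wpM2r ?dot_ge0//.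
  have -> : rb * (th ^+ 2 / (rb + 1)) = th ^+ 2 * (rb / (rb + 1)) by field; lra.
  by rewrite ler_piMr ?sqr_ge0// ler_pdivrMr//; lra.
have norm_le z : z ^+ 2 <= th ^+ 2 * dot w w ^+ 2 -> `|z| <= th * dot w w.
  by rewrite -exprMn -[X in X <= _]real_normK ?num_real// ler_pXn2r ?nnegrE// mulr_ge0// ltW.
have b0 m : w m != 0 -> block 0 m = false.
  by move=> _; apply/negbTE; rewrite negb_and -leNgt -ltNge leNgt orNb.
have bn m : w m != 0 -> block n m = true by move=> /ws.
have h0 := norm_le _ (resolvent_at_approx fw b0 rw).
have h1 := norm_le _ (resolvent_at_approx fw bn rw).
have [c1 c2] := reciprocal_comparison p0 p'0 pp w0 erefl h0 h1.
have tel := block_telescope x n fw.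
rewrite (big_cat_nat (leq0n N0) nJ)/= big_nat big1 ?add0r in tel; last first.
  by move=> j /wJ ->; rewrite expr0n mulr0.
case: pos hJ => hJ.
- apply: c1; rewrite -subr_ge0 tel big_nat; apply: sumr_ge0 => j /andP[Jj _].
  apply: mulr_ge0; last exact: sqr_ge0.
  by apply: mulr_ge0; [exact: ltW|rewrite ltW// hJ].
- apply: c2; rewrite -subr_le0 tel big_nat; apply: sumr_le0 => j /andP[Jj _].
  apply: mulr_le0_ge0; last exact: sqr_ge0.
  rewrite (pmulr_rle0 _ lam_gt0) leNgt.
  by rewrite hJ.
Qed.

(** The sign of the eventual coupling does not depend on e: either no
    approximate eigenvalue lies between - t and - s, or all of them do. *)
Theorem spectral_dichotomy : [set: X] !=set0 ->
  (forall e, approx_eigenvalue e -> 0 < (e + s) * (e + t)) \/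
  (forall e, approx_eigenvalue e -> (e + s) * (e + t) < 0).
Proof.
move=> /coupling_sign_eventually[pos [N0 hJ]].
by case: pos hJ => hJ; [left|right] => e ae; exact: (approx_eigenvalue_sign hJ ae).
Qed.

End dichotomy.

(** * Spectra on complex square-summable sequences *)

Section complex_sequences.
Context {R : realType}.
Implicit Types (u w : int -> R[i]) (v : int -> R) (C e : R).

Definition re_seq u : int -> R := fun n => complex.Re (u n).
Definition im_seq u : int -> R := fun n => complex.Im (u n).
Definition of_real (p q : int -> R) : int -> R[i] := fun n => (p n +i* q n)%C.

Lemma sqr_normc_ReIm (z : R[i]) : Normc.normc z ^+ 2 = complex.Re z ^+ 2 + complex.Im z ^+ 2.
Proof. by case: z => a b /=; rewrite sqr_sqrtr// addr_ge0 ?sqr_ge0. Qed.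

Lemma ell2_sqnorm_ge0 u : (0 <= ell2_sqnorm u)%E.
Proof. by apply: esum_ge0 => n _; rewrite lee_fin sqr_ge0. Qed.

Lemma ell2_sqnorm_leP C u : reflect
  (forall s : seq int, uniq s -> \sum_(n <- s) (re_seq u n ^+ 2 + im_seq u n ^+ 2) <= C)
  (ell2_sqnorm u <= C%:E)%E.
Proof.
have sE (s : seq int) :
    (\sum_(n <- s) (Normc.normc (u n) ^+ 2)%:E)%E =
    (\sum_(n <- s) (re_seq u n ^+ 2 + im_seq u n ^+ 2))%:E.
  by rewrite sumEFin; congr (_%:E); apply: eq_bigr => n _; exact: sqr_normc_ReIm.
apply: (iffP idP) => [h s us|h].
  rewrite -lee_fin -sE; apply: le_trans h; apply: ereal_sup_ubound.
  by exists [set` s]; [split=> //; exact: finite_seq|rewrite -fsbig_seq].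
apply: ge_ereal_sup => _ [A [fA _] <-].
rewrite fsbig_finite//= sE lee_fin; apply: h; exact: finmap.fset_uniq.
Qed.

Lemma ell2_l2 u : ell2 u ->
  l2 (fine (ell2_sqnorm u)) (re_seq u) /\ l2 (fine (ell2_sqnorm u)) (im_seq u).
Proof.
move=> eu; have uE : (ell2_sqnorm u <= (fine (ell2_sqnorm u))%:E)%E.
  by rewrite fineK// ge0_fin_numE// ell2_sqnorm_ge0.
move/ell2_sqnorm_leP : uE => h; split=> s us; apply: le_trans (h s us).
  by apply: ler_sum => n _; rewrite lerDl sqr_ge0.
by apply: ler_sum => n _; rewrite lerDr sqr_ge0.
Qed.

Lemma l2_ell2_sqnorm C C' u : l2 C (re_seq u) -> l2 C' (im_seq u) ->
  (ell2_sqnorm u <= (C + C')%:E)%E.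
Proof.
move=> h h'; apply/ell2_sqnorm_leP => s us; rewrite big_split/=.
by apply: lerD; [exact: h|exact: h'].
Qed.

Lemma l2_ell2 C C' u : l2 C (re_seq u) -> l2 C' (im_seq u) -> ell2 u.
Proof. by move=> h h'; apply: le_lt_trans (l2_ell2_sqnorm h h') _; rewrite ltry. Qed.

Lemma l2_0 : l2 (0 : R) 0.
Proof. by move=> s _; rewrite big1// => n _; rewrite expr0n. Qed.

Lemma ell2_norm_real p : finitary p -> ell2_norm (of_real p 0) = Num.sqrt (dot p p).
Proof.
move=> fp; congr (Num.sqrt _); suff -> : ell2_sqnorm (of_real p 0) = (dot p p)%:E by [].
apply/eqP; rewrite eq_le; apply/andP; split.
  rewrite -[dot p p]addr0; apply: l2_ell2_sqnorm; [exact: l2_finitary|exact: l2_0].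
have [s us h] := finitary_uniq fp.
rewrite (@dotE _ s)//; last by move=> n ns; rewrite h ?mul0r.
have -> : (\sum_(n <- s) p n * p n)%:E =
    (\sum_(n \in [set` s]) (Normc.normc (of_real p 0 n) ^+ 2)%:E)%E.
  rewrite -fsbig_seq// sumEFin; congr (_%:E); apply: eq_bigr => n _.
  by rewrite sqr_normc_ReIm /= expr0n/= addr0 expr2.
by apply: ereal_sup_ubound; exists [set` s] => //; split=> //; exact: finite_seq.
Qed.

Lemma ell2_real p : finitary p -> ell2 (of_real p 0).
Proof. by move=> fp; apply: (@l2_ell2 (dot p p) 0); [exact: l2_finitary|exact: l2_0]. Qed.

Definition complex_jacobi v u : int -> R[i] :=
  fun n => u (n + 1) + u (n - 1) + (v n)%:C%C * u n.

Lemma re_complex_jacobi v e u :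
  re_seq (complex_jacobi v u - e%:C%C *: u) = jacobi (shift_energy v e) (re_seq u).
Proof.
apply/funext => n; rewrite /re_seq /complex_jacobi /jacobi /shift_energy !fctE /GRing.scale/=.
by case: (u (n + 1)) (u (n - 1)) (u n) => a b [c d] [f g] /=; ring.
Qed.

Lemma im_complex_jacobi v e u :
  im_seq (complex_jacobi v u - e%:C%C *: u) = jacobi (shift_energy v e) (im_seq u).
Proof.
apply/funext => n; rewrite /im_seq /complex_jacobi /jacobi /shift_energy !fctE /GRing.scale/=.
by case: (u (n + 1)) (u (n - 1)) (u n) => a b [c d] [f g] /=; ring.
Qed.

Lemma seq_eqP u w : re_seq u = re_seq w -> im_seq u = im_seq w -> u = w.
Proof.
move=> h h'; apply/funext => n.
have := congr1 (fun p => p n) h; have := congr1 (fun p => p n) h'.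
by rewrite /re_seq /im_seq; case: (u n) (w n) => a b [c d] /= -> ->.
Qed.

Lemma complex_jacobi_real v e p :
  complex_jacobi v (of_real p 0) - e%:C%C *: of_real p 0 =
  of_real (jacobi (shift_energy v e) p) 0.
Proof.
apply: seq_eqP; first by rewrite re_complex_jacobi.
rewrite im_complex_jacobi; apply/funext => n.
by rewrite /jacobi /im_seq /of_real/= mulr0 !addr0.
Qed.

(** Test the bounded inverse on real finitary sequences. *)
Lemma bounded_below_of_resolvent_set v e : resolvent_set (complex_jacobi v) e%:C%C ->
  exists2 k, 0 < k & bounded_below k (shift_energy v e).
Proof.
case=> B [[_ _ [M BM]] BK].
have M0 : 0 < M ^+ 2 + 1 by have := sqr_ge0 M; lra.
exists (M ^+ 2 + 1)^-1; first by rewrite invr_gt0.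
move=> p fp; rewrite ler_pdivrMl//; have fjp := finitary_jacobi (shift_energy v e) fp.
have [_] := BK _ (ell2_real fp); rewrite complex_jacobi_real => E.
have := BM _ (ell2_real fjp); rewrite E !ell2_norm_real// => h.
have : Num.sqrt (dot p p) ^+ 2 <=
    (M * Num.sqrt (dot (jacobi (shift_energy v e) p) (jacobi (shift_energy v e) p))) ^+ 2.
  by rewrite ler_pXn2r ?nnegrE ?sqrtr_ge0// (le_trans (sqrtr_ge0 _) h).
rewrite exprMn !sqr_sqrtr ?dot_ge0// mulrDl mul1r.
by have := dot_ge0 (jacobi (shift_energy v e) p); lra.
Qed.

(** The potential being real, the inverse acts separately on real and imaginary
    parts. *)
Lemma resolvent_set_of_bounded_below v e (M k : R) : (forall n, `|shift_energy v e n| <= M) ->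
  0 < k -> bounded_below k (shift_energy v e) -> resolvent_set (complex_jacobi v) e%:C%C.
Proof.
move=> vM k0 lv; set v' := shift_energy v e in vM lv.
pose B u := of_real (resolvent M v' (re_seq u)) (resolvent M v' (im_seq u)).
pose rb := @resolvent_bound R M k.
have BN u : ell2 u -> l2 (rb * fine (ell2_sqnorm u)) (re_seq (B u)) /\
    l2 (rb * fine (ell2_sqnorm u)) (im_seq (B u)).
  by move=> /ell2_l2[h h']; split; exact: (l2_resolvent vM k0 lv).
exists B; split.
- split.
  + by move=> u /BN[h h']; exact: l2_ell2 h h'.
  + move=> c u w /ell2_l2[ru iu] /ell2_l2[rw iw].
    apply: seq_eqP.
      rewrite (_ : re_seq (B _) = resolvent M v'
        ((complex.Re c *: re_seq u + (- complex.Im c) *: im_seq u) + re_seq w)); last first.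
        rewrite /B; congr resolvent.
        apply/funext => n; rewrite /re_seq /im_seq !fctE /GRing.scale/=.
        by case: c (u n) (w n) => a b [x y] [x' y'] /=; ring.
      rewrite (resolventD vM k0 lv (l2D (l2Z _ ru) (l2Z _ iu)) rw).
      rewrite (resolventD vM k0 lv (l2Z _ ru) (l2Z _ iu)).
      rewrite (resolventZ vM k0 lv _ ru) (resolventZ vM k0 lv _ iu).
      apply/funext => n; rewrite /B /of_real /re_seq !fctE /GRing.scale/=.
      by case: c => a b /=; ring.
    rewrite (_ : im_seq (B _) = resolvent M v'
        ((complex.Re c *: im_seq u + complex.Im c *: re_seq u) + im_seq w)); last first.
      rewrite /B; congr resolvent.
      apply/funext => n; rewrite /re_seq /im_seq !fctE /GRing.scale/=.
      by case: c (u n) (w n) => a b [x y] [x' y'] /=; ring.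
    rewrite (resolventD vM k0 lv (l2D (l2Z _ iu) (l2Z _ ru)) iw).
    rewrite (resolventD vM k0 lv (l2Z _ iu) (l2Z _ ru)).
    rewrite (resolventZ vM k0 lv _ ru) (resolventZ vM k0 lv _ iu).
    apply/funext => n; rewrite /B /of_real /im_seq !fctE /GRing.scale/=.
    by case: c => a b /=; ring.
  + exists (Num.sqrt (rb + rb)) => u eu; have [h h'] := BN u eu.
    have N0 : 0 <= fine (ell2_sqnorm u) by rewrite fine_ge0// ell2_sqnorm_ge0.
    rewrite /ell2_norm -sqrtrM; last first.
      have := l2_resolvent vM k0 lv (l2_finitary (finitary_delta 0)).
      by move=> /l2_ge0; rewrite dot_deltal /delta eqxx mulr1 -/rb => ?; rewrite addr_ge0.
    rewrite ler_wsqrtr// mulrDl -lee_fin fineK; first exact: l2_ell2_sqnorm.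
    by rewrite ge0_fin_numE ?ell2_sqnorm_ge0//; exact: l2_ell2 h h'.
- move=> u /ell2_l2[ru iu]; split; apply: seq_eqP.
  + by rewrite re_complex_jacobi -/v' (jacobi_resolvent vM k0 lv ru).
  + by rewrite im_complex_jacobi -/v' (jacobi_resolvent vM k0 lv iu).
  + rewrite (_ : re_seq (B _) = resolvent M v' (jacobi v' (re_seq u))); last first.
      by rewrite -re_complex_jacobi.
    exact: (resolvent_jacobi vM k0 lv ru).
  + rewrite (_ : im_seq (B _) = resolvent M v' (jacobi v' (im_seq u))); last first.
      by rewrite -im_complex_jacobi.
    exact: (resolvent_jacobi vM k0 lv iu).
Qed.

End complex_sequences.

(** * Compact sets covered by long segments *)

Lemma compact_within_bound (R : realType) (K : set R) : compact K ->
  exists2 B, 0 <= B & forall x, K x -> `|x| <= B.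
Proof.
move=> /compact_bounded[B [_ hB]]; exists (`|B| + 1); first by rewrite addr_ge0.
by move=> x Kx; apply: hB => //; rewrite (le_lt_trans (ler_norm _))// ltrDl.
Qed.

(** Every segment of length d contains a point of a grid of mesh d / 2, and the
    compact set contains finitely many grid points; their connected components
    are the segments sought. *)
Lemma finite_union_of_segments (R : realType) (K : set R) (d : R) :
  compact K -> 0 < d ->
  (forall x, K x -> exists a b, [/\ a <= x <= b, d <= b - a & `[a, b]%classic `<=` K]) ->
  exists (n : nat) (a b : 'I_n -> R), (forall i, a i < b i) /\
    K = \bigcup_(i in [set: 'I_n]) `[a i, b i]%classic.
Proof.
move=> cK d0 hK; have [B B0 KB] := compact_within_bound cK.
have clK : closed K by apply: compact_closed => //; exact: Rhausdorff.
have seg x y z : (`[x, y]%classic z) = (x <= z <= y) :> Prop by rewrite set_itvE.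
have notK x : ~ K x -> exists2 r : R, 0 < r & forall y, `|x - y| < r -> ~ K y.
  move=> nKx; have : nbhs x (~` K) by apply: open_nbhs_nbhs; split=> //; exact: closed_openC.
  by move=> /nbhs_ballP[r r0 h]; exists r => // y xy; apply: (h y).
pose left g := [set y | y <= g /\ `[y, g]%classic `<=` K].
pose right g := [set y | g <= y /\ `[g, y]%classic `<=` K].
pose lo g := inf (left g); pose hi g := sup (right g).
have left0 g : K g -> left g g.
  by move=> Kg; split=> // y; rewrite seg -eq_le => /eqP <-.
have right0 g : K g -> right g g.
  by move=> Kg; split=> // y; rewrite seg -eq_le => /eqP <-.
have leftB g y : left g y -> - B <= y.
  move=> [yg yK]; have /KB : K y by apply: yK; rewrite seg lexx yg.
  by rewrite ler_norml => /andP[].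
have rightB g y : right g y -> y <= B.
  move=> [yg yK]; have /KB : K y by apply: yK; rewrite seg lexx yg.
  by rewrite ler_norml => /andP[].
have infl g : K g -> has_inf (left g).
  by move=> Kg; split; [exists g; exact: left0|exists (- B) => y; exact: leftB].
have supr g : K g -> has_sup (right g).
  by move=> Kg; split; [exists g; exact: right0|exists B => y; exact: rightB].
have sub g : K g -> `[lo g, hi g]%classic `<=` K.
  move=> Kg z; rewrite seg => /andP[lz zh].
  have [zg|gz] := leP z g.
    apply: contrapT => /notK[r r0 hr].
    have [y yl ylt] := inf_adherent r0 (infl g Kg).
    have [yg yK] := yl; rewrite -/(lo g) in ylt.
    have [yz|zy] := leP y z.
      apply: (hr z); first by rewrite subrr normr0.
      by apply: yK; rewrite seg yz zg.
    apply: (hr y); last by apply: yK; rewrite seg lexx yg.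
    by rewrite ltr0_norm ?subr_lt0//; lra.
  apply: contrapT => /notK[r r0 hr].
  have [y yl ylt] := sup_adherent r0 (supr g Kg).
  have [yg yK] := yl; rewrite -/(hi g) in ylt.
  have [zy|yz] := leP z y.
    apply: (hr z); first by rewrite subrr normr0.
    by apply: yK; rewrite seg zy (ltW gz).
  apply: (hr y); last by apply: yK; rewrite seg lexx yg.
  by rewrite gtr0_norm ?subr_gt0//; lra.
have lo_le g a b : K g -> a <= g <= b -> `[a, b]%classic `<=` K -> lo g <= a /\ b <= hi g.
  move=> Kg /andP[ag gb] abK; split.
    apply: ge_inf; first exact: (infl g Kg).2.
    by split=> // y; rewrite seg => /andP[ay yg]; apply: abK; rewrite seg ay (le_trans yg).
  apply: ub_le_sup; first exact: (supr g Kg).2.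
  by split=> // y; rewrite seg => /andP[gy yb]; apply: abK; rewrite seg yb (le_trans ag).
pose grid i : R := - B + i%:R * (d / 2).
pose n0 := (Num.truncn (2 * B / (d / 2))).+2.
pose l := [seq i <- iota 0 n0 | `[< K (grid i) >]].
pose gi (i : 'I_(size l)) := grid (nth 0%N l i).
have Kgi i : K (gi i).
  have : nth 0%N l i \in l by exact: mem_nth.
  by rewrite mem_filter => /andP[/asboolP].
exists (size l), (lo \o gi), (hi \o gi); split=> [i /=|].
  have [a [b [/andP[ag gb] dab abK]]] := hK _ (Kgi i).
  have [h1 h2] := lo_le _ a b (Kgi i) ltac:(by rewrite ag gb) abK; lra.
apply/seteqP; split=> [x Kx|x [i _]]; last exact: sub.
have [a [b [/andP[ax xb] dab abK]]] := hK _ Kx.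
have Ka : K a by apply: abK; rewrite seg lexx (le_trans ax).
have := KB _ Ka; rewrite ler_norml => /andP[aB Ba].
have d2 : 0 < d / 2 by lra.
have t0 : 0 <= (a + B) / (d / 2) by apply: divr_ge0; lra.
have [i [ia ib iln]] : exists i : nat, [/\ (a + B) / (d / 2) < i%:R,
    i%:R <= (a + B) / (d / 2) + 1 & (i < n0)%N].
  have /andP[i1 i2] := truncn_itv t0.
  exists (Num.truncn ((a + B) / (d / 2))).+1; split=> //.
    by rewrite -natr1 lerD2r.
  rewrite /n0 !ltnS; apply: le_truncn.
  by rewrite ler_pM2r ?invr_gt0//; lra.
have gl : a <= grid i.
  by move: ia; rewrite ltr_pdivrMr// /grid; lra.
have gu : grid i <= b.
  by move: ib; rewrite -lerBlDr ler_pdivlMr// /grid mulrBl mul1r; lra.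
have Kg : K (grid i) by apply: abK; rewrite seg gl gu.
have il : i \in l.
  rewrite mem_filter; apply/andP; split; first exact/asboolP.
  by rewrite mem_iota /= add0n.
have sl : (index i l < size l)%N by rewrite index_mem.
exists (Ordinal sl) => //; rewrite seg /= /gi/= nth_index//.
have [h1 h2] := lo_le _ a b Kg ltac:(by rewrite gl gu) abK.
by rewrite (le_trans h1)//= (le_trans xb).
Qed.

(** * Recurrence and full support *)

Section measures.
Context {R : realType} {X : pmetricType R}.
Variables (T : homeomorphism X) (mu : probability (borel X) R).
Hypothesis mu_support : measure_support (mu : set X -> \bar R) = [set: X].

Lemma open_borel (U : set X) : open U -> measurable (U : set (borel X)).
Proof. exact: sub_sigma_algebra. Qed.

Lemma open_mu_gt0 (U : set X) : open U -> U !=set0 -> (0 < mu U)%E.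
Proof.
move=> oU [x Ux].
have : measure_support (mu : set X -> \bar R) x by rewrite mu_support.
by move=> /(_ U oU Ux).
Qed.

Lemma iter_homeo_continuous k : continuous (iter k T).
Proof.
elim: k => [|k IH]; first by move=> x; exact: cvg_id.
by move=> x /=; apply: continuous_comp; [exact: IH|exact: homeo_continuous].
Qed.

(** Poincare recurrence: without such a return, infinitely many preimages of U
    would be disjoint, all of the same positive measure. *)
Lemma recurrence (U : set X) (N : nat) : ergodic mu T -> open U -> U !=set0 ->
  exists2 k, (N <= k)%N & exists2 x, U x & U (iter k T x).
Proof.
move=> [muT _] oU U0; apply: contrapT => noret.
have Upos := open_mu_gt0 oU U0.
pose F j := (iter (j * N.+1) T @^-1` U : set (borel X)).
have oF k : open (iter k T @^-1` U).
  by apply: open_comp => // y _; exact: iter_homeo_continuous.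
have mF j : measurable (F j) by apply: open_borel; exact: oF.
have muiter k : mu (iter k T @^-1` U) = mu U.
  elim: k => [//|k <-]; rewrite -[RHS]muT; last exact: open_borel.
  by congr (mu _); apply/funext => x; rewrite /preimage /mkset iterSr.
have tF : trivIset setT F.
  apply/trivIsetP; suff H i j : (i < j)%N -> F i `&` F j = set0.
    by move=> i j _ _; rewrite neq_ltn => /orP[/H//|/H]; rewrite setIC.
  move=> ij; apply/seteqP; split=> // x [Ui Uj]; apply: noret.
  exists ((j - i) * N.+1)%N.
    by rewrite (leq_trans (leqnSn N))// leq_pmull// subn_gt0.
  by exists (iter (i * N.+1) T x) => //; rewrite -iterD -mulnDl subnK// ltnW.
have fU : (mu U \is a fin_num)%E by rewrite fin_num_measure//; exact: open_borel.
pose r := fine (mu U).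
have r0 : 0 < r by rewrite -lte_fin fineK.
have h n : n%:R * r <= 1.
  have mFn : measurable (\big[setU/set0]_(i < n) F i) by exact: bigsetU_measurable.
  have := probability_le1 mu mFn.
  rewrite measure_bigsetU// -lee_fin; apply: le_trans.
  rewrite (eq_bigr (fun=> r%:E)) => [|i _]; last by rewrite /r fineK//; exact: muiter.
  by rewrite sumEFin lee_fin sumr_const card_ord mulr_natl.
have := h (Num.truncn r^-1).+1; rewrite leNgt => /negP; apply.
by rewrite -ltr_pdivrMr// mul1r truncnS_gt.
Qed.

Lemma homeo_iterS n x : homeo_iter T (n + 1) x = homeo_iter T n (T x).
Proof.
case: n => [k|[|k]]; first by rewrite -PoszD addn1 /= -iterS iterSr.
  have -> : Negz 0 + 1 = 0 by lia.
  by rewrite /= homeoK.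
have -> : Negz k.+1 + 1 = Negz k by lia.
rewrite /homeo_iter.
by rewrite [in RHS]iterSr homeoK.
Qed.

Lemma homeo_iter_continuous n : continuous (homeo_iter T n).
Proof.
case: n => k; first exact: iter_homeo_continuous.
rewrite /homeo_iter; elim: k.+1 => [|j IH]; first by move=> x; exact: cvg_id.
by move=> x /=; apply: continuous_comp; [exact: IH|exact: homeo_inv_continuous].
Qed.

Variables (nu : probability R R) (P : probability (sequence_space nu) R).
Hypothesis P_product : is_product_measure P.

(** An open box around [(x, w)] in finitely many coordinates has positive measure,
    so that it contains a point where the almost sure property holds. *)
Lemma product_support (Q : borel X * sequence_space nu -> Prop) (f : X -> R)
    (x : X) (w : sequence_space nu) (s : seq int) (e : R) :
  continuous f -> {ae (mu \x P)%E, forall xw, Q xw} -> 0 < e ->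
  exists x' w', Q (x', w') /\ forall n, n \in s ->
    `|f (homeo_iter T n x') - f (homeo_iter T n x)| < e /\
    `|support_val (w' n) - support_val (w n)| < e.
Proof.
move=> cf aeQ e0; pose s' := undup s.
have nU : \forall y \near x, forall n, n \in s' ->
    `|f (homeo_iter T n y) - f (homeo_iter T n x)| < e.
  apply: near_in_seq => n.
  have : {for x, continuous (f \o homeo_iter T n)}.
    by apply: continuous_comp; [exact: homeo_iter_continuous|exact: cf].
  move=> /cvgrPdist_lt/(_ e e0); apply: filterS => y /=; by rewrite distrC.
pose U := [set y | forall n, n \in s' -> `|f (homeo_iter T n y) - f (homeo_iter T n x)| < e]°.
have oU : open U by exact: open_interior.
have mU : measurable (U : set (borel X)) by exact: open_borel.
have U0 : (0 < mu U)%E by apply: open_mu_gt0 => //; exists x.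
pose A n : set R := ball (support_val (w n)) e.
have mA n : measurable (A n) by apply: measurable_realfun.open_measurable; exact: ball_open.
pose C : set (sequence_space nu) := [set w' | forall n, n \in s' -> A n (support_val (w' n))].
have mC : measurable C.
  have -> : C = \bigcap_(n in [set` s']) [set w' : sequence_space nu | A n (support_val (w' n))] by [].
  apply: fin_bigcap_measurable; first exact: finite_seq.
  by move=> n _; apply: sub_sigma_algebra; exists n, (A n).
have C0 : (0 < P C)%E.
  rewrite (P_product (undup_uniq s) mA); elim/big_ind : _ => //.
    by move=> a b a0 b0; rewrite mule_gt0.
  move=> n _; have := set_valP (w n); apply; first exact: ball_open.
  exact: ballxx.
case: aeQ => N [mN N0 subN].
have : ~ (U `*` C `<=` N).
  move=> UCN; have : ((mu \x P)%E (U `*` C) <= (mu \x P)%E N)%E.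
    by apply: le_measure => //; rewrite inE//; exact: measurableX.
  by rewrite N0 product_measure1E// leNgt mule_gt0.
move=> /existsNP[[x' w']] /not_implyP[[Ux Cw] nN].
exists x', w'; split; first by apply: contrapT => nQ; apply: nN; exact: subN.
move=> n; rewrite -mem_undup => ns; split; first exact: (interior_subset Ux).
by have := Cw n ns; rewrite /A /ball/= distrC.
Qed.

End measures.

(** * The almost sure spectrum *)

(** A perturbation of norm d cannot destroy a bound from below with constant
    larger than d. *)
Lemma bounded_below_add (R : realType) (k d : R) (v w : int -> R) :
  bounded_below k v -> (forall n, `|w n| <= d) -> d ^+ 2 < k ->
  exists2 k', 0 < k' & bounded_below k' (v + w).
Proof.
move=> lv wd dk.
have d0 : 0 <= d by exact: le_trans (normr_ge0 _) (wd 0).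
pose t := (k - d ^+ 2) / (2 * d ^+ 2 + 1).
have dd : 0 <= d ^+ 2 := sqr_ge0 d.
have t0 : 0 < t by rewrite divr_gt0//; lra.
have td : t * d ^+ 2 <= (k - d ^+ 2) / 2.
  have -> : (k - d ^+ 2) / 2 = t * (d ^+ 2 + 1 / 2) by rewrite /t; field; lra.
  by rewrite ler_pM2l//; lra.
exists ((k - d ^+ 2) / 2 / (1 + t^-1)).
  by apply: divr_gt0; [lra|rewrite addr_gt0 ?invr_gt0].
move=> u fu; have fx := finitary_jacobi (v + w) fu.
pose b : int -> R := fun n => w n * u n.
have fb : finitary b by exact: finitaryM.
have jacobi_E : jacobi v u = jacobi (v + w) u - b.
  by apply/funext => n; rewrite /jacobi /b !fctE; ring.
have bd : dot b b <= d ^+ 2 * dot u u.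
  apply: dot_mul_le => // n _; rewrite -[w n ^+ 2]real_normK ?num_real//.
  by rewrite ler_pXn2r ?nnegrE.
have := lv u fu; rewrite jacobi_E; move: (jacobi (v + w) u) fx => x fx.
have : 0 <= dot x x + t * dot x b + (t * dot x b + t * (t * dot b b)).
  have := dot_ge0 (x + t *: b).
  by rewrite dotDl ?dotDr; auto; rewrite !(dotZl, dotZr) (dotC b x).
move=> h1; rewrite dotBl ?dotBr; auto; rewrite (dotC b x) => h2.
have u0 := dot_ge0 u.
have t1 : 0 < 1 + t^-1 by rewrite addr_gt0 ?invr_gt0.
have ti : t^-1 * t = 1 by rewrite mulVf ?gt_eqF.
rewrite -mulrA mulrCA -ler_pdivlMl ?invr_gt0// invrK.
have h3 : 0 <= t^-1 * dot x x + 2 * dot x b + t * dot b b.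
  have := mulr_ge0 (ltW (_ : 0 < t^-1)) h1; rewrite invr_gt0 => /(_ t0).
  have -> : t^-1 * (dot x x + t * dot x b + (t * dot x b + t * (t * dot b b))) =
    t^-1 * dot x x + (t^-1 * t) * (2 * dot x b + t * dot b b) by ring.
  by rewrite ti; lra.
have h4 : t * dot b b <= (k - d ^+ 2) / 2 * dot u u.
  apply: le_trans (ler_wpM2l (ltW t0) bd) _.
  by rewrite mulrA ler_wpM2r.
lra.
Qed.

Section random_operator.
Context {R : realType} {X : pmetricType R}.
Variables (T : homeomorphism X) (mu : probability (borel X) R) (f : X -> R).
Variables (nu : probability R R) (P : probability (sequence_space nu) R).
Variable Sigma : set R.
Hypothesis X_compact : compact [set: X].
Hypothesis mu_ergodic : ergodic mu T.
Hypothesis mu_support : measure_support (mu : set X -> \bar R) = [set: X].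
Hypothesis f_continuous : continuous f.
Hypothesis nu_compact : compact (measure_support (nu : set R -> \bar R)).
Hypothesis nu_card : (`I_2 #<= measure_support (nu : set R -> \bar R))%card.
Hypothesis P_product : is_product_measure P.
Hypothesis Sigma_spectrum : almost_sure_spectrum T mu f P Sigma.
Hypothesis X_connected : connected [set: X].

Let S := measure_support (nu : set R -> \bar R).

Let V (x : X) : int -> R := fun n => f (homeo_iter T n x).
Let W (w : int -> support_type nu) : int -> R := fun n => support_val (w n).

Let operatorE x (w : sequence_space nu) :
  schroedinger T f x + random_potential w = complex_jacobi (V x + W w).
Proof.
apply/funext => u; apply/funext => n; rewrite /schroedinger /random_potential.
rewrite /complex_jacobi /V /W !fctE.
by rewrite rmorphD/= mulrDl addrA.
Qed.

Let f_bounded : exists2 B, 0 <= B & forall x, `|f x| <= B.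
Proof.
have : compact (f @` [set: X]).
  by apply: continuous_compact => //; apply: continuous_subspaceT.
move=> /compact_within_bound[B B0 h]; exists B => // x; apply: h; by exists x.
Qed.

Let pot_bounded : exists2 M, 0 <= M & forall x w n, `|(V x + W w) n| <= M.
Proof.
have [B B0 fB] := f_bounded; have [C C0 SC] := compact_within_bound nu_compact.
exists (B + C); first by rewrite addr_ge0.
move=> x w n; rewrite fctE; apply: le_trans (ler_normD _ _) _; apply: lerD; first exact: fB.
by apply: SC; exact: set_valP.
Qed.

Let typical x (w : sequence_space nu) :=
  forall e, Sigma e <-> spectrum (schroedinger T f x + random_potential w) e%:C%C.

Let typical_ae : {ae (mu \x P)%E, forall xw : borel X * sequence_space nu, typical xw.1 xw.2}.
Proof.
case: Sigma_spectrum => _; apply: filterS => -[x w] /= spE e.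
rewrite spE; split=> [Se|[e' Se' []]].
  by exists e.
by move=> <-.
Qed.

(** Off the almost sure spectrum, [bounded_below_distance] provides the typical
    operators with a common constant, which passes to all operators. *)
Let off_spectrum E : ~ Sigma E -> exists2 k, 0 < k &
  forall x w, bounded_below k (shift_energy (V x + W w) E).
Proof.
move=> nSE; have [M M0 potM] := pot_bounded.
have clS : closed Sigma.
  by apply: compact_closed; [exact: Rhausdorff|case: Sigma_spectrum].
have [d d0 hd] : exists2 d, 0 < d & forall e, `|e| <= d -> ~ Sigma (E + e).
  have : nbhs E (~` Sigma) by apply: open_nbhs_nbhs; split=> //; exact: closed_openC.
  move=> /nbhs_ballP[r /= r0 h]; exists (r / 2); first by rewrite divr_gt0.
  move=> e er; apply: h; rewrite /ball/= opprD addNKr normrN.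
  by apply: le_lt_trans er _; lra.
have typ x w : typical x w -> bounded_below (d ^+ 2) (shift_energy (V x + W w) E).
  move=> tw; pose A := [set shift_energy (V x + W w) E].
  have AM v : A v -> forall n, `|v n| <= M + `|E|.
    move=> -> n; rewrite /shift_energy; apply: le_trans (ler_normB _ _) _.
    by rewrite lerD2r.
  have [||k dk lk] := bounded_below_distance (A := A) _ AM (ltW d0).
  - by exists (shift_energy (V x + W w) E).
  - move=> e ed; have := hd e ed; rewrite tw operatorE => /contrapT.
    move=> /bounded_below_of_resolvent_set[k k0 lk]; exists k => // _ ->.
    suff -> : shift_energy (shift_energy (V x + W w) E) e =
      shift_energy (V x + W w) (E + e) by [].
    by apply/funext => n; rewrite /shift_energy opprD addrA.
  - move=> u fu; apply: le_trans (lk _ erefl u fu).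
    by rewrite ler_wpM2r ?dot_ge0// ltW.
exists (d ^+ 2 / 4); first by rewrite divr_gt0// exprn_gt0.
move=> x w u fu; have [s hs] := fu.
have d4 : 0 < d / 4 by lra.
have [x' [w' [tw hw]]] := product_support T mu_support P_product x w s
  f_continuous typical_ae d4.
apply: (bounded_below_perturb (typ _ _ tw) fu) => n un.
have ns : n \in s by apply: contraNT un => /hs ->.
have [h1 h2] := hw n ns.
have -> : d ^+ 2 / 4 = (d / 2) ^+ 2 by field.
rewrite -[X in X <= _]real_normK ?num_real// ler_pXn2r ?nnegrE//; last by lra.
have -> : shift_energy (V x' + W w') E n - shift_energy (V x + W w) E n =
  (f (homeo_iter T n x') - f (homeo_iter T n x)) + (support_val (w' n) - support_val (w n)).
  by rewrite /shift_energy /V /W !fctE; ring.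
by apply: le_trans (ler_normD _ _) _; lra.
Qed.

Let on_spectrum E : Sigma E ->
  (forall x w, exists2 k, 0 < k & bounded_below k (shift_energy (V x + W w) E)) -> False.
Proof.
move=> SE h; have [M M0 potM] := pot_bounded.
have [x [w [tw _]]] := product_support T mu_support P_product point (fun=> point) [::]
  f_continuous typical_ae ltr01.
have [k k0 lk] := h x w.
move: SE; rewrite tw operatorE; apply.
apply: (@resolvent_set_of_bounded_below _ _ _ (M + `|E|) k) => // n.
by rewrite /shift_energy; apply: le_trans (ler_normB _ _) _; rewrite lerD2r.
Qed.

Let approx := approx_eigenvalue V.

Let V_continuous n : continuous (V^~ n).
Proof.
move=> x; apply: continuous_comp; first exact: homeo_iter_continuous.
exact: f_continuous.
Qed.

Let V_T x n : V x (n + 1) = V (T x) n.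
Proof. by rewrite /V homeo_iterS. Qed.

Let X0 : [set: X] !=set0. Proof. by exists point. Qed.

(** [spectral_dichotomy] for the sequences with values in {s, t}. *)
Let dichotomy E s t : ~ Sigma E -> S s -> S t -> s < t ->
  (forall e, approx e -> 0 < (e - (E - s)) * (e - (E - t))) \/
  (forall e, approx e -> (e - (E - s)) * (e - (E - t)) < 0).
Proof.
move=> /off_spectrum[k k0 lk] Ss St st; have [M M0 potM] := pot_bounded.
pose w (b : int -> bool) : int -> support_type nu :=
  fun n => if b n then SigSub (mem_set St) else SigSub (mem_set Ss).
have bb x b : admissible (M + `|E|) k (mixture V (s - E) (t - E) x b).
  have -> : mixture V (s - E) (t - E) x b = shift_energy (V x + W (w b)) E.
    apply/funext => n; rewrite /mixture /shift_energy /W /w !fctE /support_val.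
    by case: (b n); rewrite addrA.
  split; last exact: lk.
  by move=> n; rewrite /shift_energy; apply: le_trans (ler_normB _ _) _; rewrite lerD2r.
have st' : s - E < t - E by rewrite ltrD2r.
have := spectral_dichotomy X_connected V_continuous (homeo_continuous (h := T)) V_T
  (fun U N => @recurrence _ _ T mu mu_support U N mu_ergodic) k0 st' bb X0.
have eqE e : (e + (s - E)) * (e + (t - E)) = (e - (E - s)) * (e - (E - t)) by ring.
by case=> h; [left|right] => e /h; rewrite eqE.
Qed.

Let approxP (e : R) :
  (~ exists2 k, 0 < k & forall v, [set V x | x in [set: X]] v ->
    bounded_below k (shift_energy v e)) ->
  approx e.
Proof.
move=> h eps eps0; apply: contrapT => h'; apply: h; exists eps => // v [x _ <-] u fu.
rewrite leNgt; apply/negP => lt; apply: h'; by exists x, u.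
Qed.

(** The two ends are distinct: the forms at [delta 0 + delta 1] and at
    [delta 0 - delta 1] differ by the hopping terms. *)
Let form_bounds : exists m M, [/\ approx m, approx M, m < M,
  forall x u, finitary u -> m * dot u u <= dot (jacobi (V x) u) u &
  forall x u, finitary u -> dot (jacobi (V x) u) u <= M * dot u u].
Proof.
have [B B0 fB] := f_bounded; pose A := [set V x | x in [set: X]].
have A0 : A !=set0 by exists (V point), point.
have AB v : A v -> forall n, `|v n| <= B by move=> [x _ <-] n; exact: fB.
have [M hM nM] := form_extremum A0 AB (expr1n R 2).
have [m hm nm] := form_extremum A0 AB (sqrr_sign R 1).
have {}hM x u : finitary u -> dot (jacobi (V x) u) u <= M * dot u u.
  by move=> fu; have := hM (V x) u ltac:(by exists x) fu; rewrite mul1r.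
have {}hm x u : finitary u -> (- m) * dot u u <= dot (jacobi (V x) u) u.
  by move=> fu; have := hm (V x) u ltac:(by exists x) fu; lra.
exists (- m), M; split=> //.
- by apply: approxP; rewrite mulN1r in nm.
- by apply: approxP; rewrite mul1r in nM.
have jacobi_E (v : int -> R) (c : R) : let u := delta 0 + c *: delta 1 in
    dot (jacobi v u) u = v 0 + c ^+ 2 * v 1 + 2 * c /\ dot u u = 1 + c ^+ 2.
  rewrite /=; set u := delta 0 + c *: delta 1.
  have u0 : u 0 = 1 by rewrite /u !fctE /delta /GRing.scale/= mulr0 addr0.
  have u1 : u 1 = c by rewrite /u !fctE /delta /GRing.scale/= mulr1 add0r.
  have um1 : u (-1) = 0 by rewrite /u !fctE /delta /GRing.scale/= mulr0 addr0.
  have u2 : u 2 = 0 by rewrite /u !fctE /delta /GRing.scale/= mulr0 addr0.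
  have dE p : dot p u = p 0 + c * p 1.
    by rewrite {1}/u dotDr ?dotZr ?dot_deltar; auto.
  split; rewrite dE ?u0 ?u1; last by ring.
  rewrite /jacobi add0r sub0r subrr (_ : 1 + 1 = 2 :> int)// u0 u1 um1 u2; ring.
have [form1 d1] := jacobi_E (V point) 1; have [form2 d2] := jacobi_E (V point) (-1).
have := hM point _ (finitaryD (finitary_delta 0) (finitaryZ 1 (finitary_delta 1))).
have := hm point _ (finitaryD (finitary_delta 0) (finitaryZ (-1) (finitary_delta 1))).
by rewrite form1 d1 form2 d2; lra.
Qed.

(** If a point of e + [p, q] or of s + [m, M] were off the spectrum, the
    dichotomy would compare the lengths of the two segments in the wrong
    direction. *)
Lemma spectrum_segments : exists2 d, 0 < d & forall E, Sigma E ->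
  exists a b, [/\ a <= E <= b, d <= b - a & `[a, b]%classic `<=` Sigma].
Proof.
have [m [M [am aM mM hm hM]]] := form_bounds.
have S0 : S !=set0 := measure_support_neq0 nu.
have cid : {within S, continuous (@idfun R)}.
  by apply: continuous_subspaceT => x; exact: cvg_id.
have [p /set_mem Sp minp] := compact_EVT_min S0 nu_compact cid.
have [q /set_mem Sq maxq] := compact_EVT_max S0 nu_compact cid.
have {minp}minp s : S s -> p <= s by move=> Ss; apply: minp; exact: mem_set.
have {maxq}maxq s : S s -> s <= q by move=> Ss; apply: maxq; exact: mem_set.
have pq : p < q.
  have /pcard_leP[g] := nu_card.
  have g0 : S (g 0%N) by exact: (@funS _ _ `I_2 _ g).
  have g1 : S (g 1%N) by exact: (@funS _ _ `I_2 _ g).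
  rewrite lt_neqAle (minp _ Sq) andbT; apply/eqP => pqE.
  have : g 0%N = g 1%N.
    have e1 : g 0%N = p by apply/eqP; rewrite eq_le minp// andbT pqE maxq.
    by rewrite e1; apply/eqP; rewrite eq_le minp// pqE maxq.
  have injg : {in `I_2 &, injective g} by exact: inj.
  by move/injg => /(_ (mem_set isT) (mem_set isT)).
have seg x y z : (`[x, y]%classic z) = (x <= z <= y) :> Prop by rewrite set_itvE.
(* otherwise H_x is at distance more than (q - p) / 2 from E - (p + q) / 2,
   while w - (p + q) / 2 has norm at most (q - p) / 2 *)
have inc1 E : Sigma E -> exists2 e, approx e & E - q <= e <= E - p.
  move=> SE; apply: contrapT => h; apply: (on_spectrum SE) => x w.
  pose c := (p + q) / 2; pose d := (q - p) / 2.
  have d0 : 0 <= d by rewrite /d; lra.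
  have [B B0 fB] := f_bounded.
  pose A := [set shift_energy (V x) (E - c) | x in [set: X]].
  have A0 : A !=set0 by exists (shift_energy (V point) (E - c)), point.
  have AB v : A v -> forall n, `|v n| <= B + `|E - c|.
    move=> [y _ <-] n; rewrite /shift_energy; apply: le_trans (ler_normB _ _) _.
    by rewrite lerD2r; exact: fB.
  have [|k dk lk] := bounded_below_distance A0 AB d0.
    move=> e; rewrite ler_norml => /andP[e1 e2].
    have : ~ approx (E - c + e).
      move=> ae; apply: h; exists (E - c + e) => //; rewrite /c /d in e1 e2 *; lra.
    move=> /(contra_not (@approxP _)) /contrapT[k k0 lk]; exists k => // _ [y _ <-].
    have -> : shift_energy (shift_energy (V y) (E - c)) e = shift_energy (V y) (E - c + e).
      by apply/funext => n; rewrite /shift_energy; ring.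
    by apply: lk; exists y.
  have [||k' k'0 lk'] := @bounded_below_add _ k d (shift_energy (V x) (E - c))
    (fun n => W w n - c) _ _ dk.
  - by apply: lk; exists x.
  - move=> n; have Sw : S (W w n) by exact: set_valP.
    by have := minp _ Sw; have := maxq _ Sw; rewrite ler_norml /c /d; lra.
  - exists k' => //; congr bounded_below : lk'.
    by apply/funext => n; rewrite /shift_energy !fctE; ring.
(* by compactness E - s stays away from [m, M], uniformly in s *)
have inc2 E : Sigma E -> exists2 s, S s & m <= E - s <= M.
  move=> SE; apply: contrapT => h; apply: (on_spectrum SE) => x w.
  pose g s := Num.max (m - (E - s)) ((E - s) - M).
  have cg : {within S, continuous g}.
    apply: continuous_subspaceT => s.
    apply: (@continuous_max R R (fun s => m - (E - s)) (fun s => (E - s) - M)).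
      by apply: cvgB; [exact: cvg_cst|apply: cvgB; [exact: cvg_cst|exact: cvg_id]].
    by apply: cvgB; [apply: cvgB; [exact: cvg_cst|exact: cvg_id]|exact: cvg_cst].
  have [s /set_mem Ss mins] := compact_EVT_min S0 nu_compact cg.
  have g0 : 0 < g s.
    rewrite /g lt_max !subr_gt0 -[X in is_true X]negbK negb_or -!leNgt.
    apply/negP => /andP[h1 h2].
    by apply: h; exists s => //; rewrite h1.
  exists (g s ^+ 2); first by rewrite exprn_gt0.
  have := bounded_below_outside (w := fun n => W w n - E) (ltW g0) (hm x) (hM x).
  have -> : V x + (fun n => W w n - E) = shift_energy (V x + W w) E.
    by apply/funext => n; rewrite /shift_energy !fctE addrA.
  apply=> n; have Sw : S (W w n) by exact: set_valP.
  have := mins _ (mem_set Sw); rewrite {2}/g le_max => /orP[]; [left|right]; lra.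
exists (Num.min (q - p) (M - m)); first by rewrite lt_min !subr_gt0 pq mM.
move=> E SE; have [lt|ge] := ltP (q - p) (M - m).
  have [e ae /andP[e1 e2]] := inc1 E SE.
  exists (e + p), (e + q); split; [by apply/andP; split; lra|by lra|].
  move=> E'; rewrite seg => /andP[h1 h2]; apply: contrapT => nS.
  have [h|h] := dichotomy nS Sp Sq pq.
    have : (e - (E' - p)) * (e - (E' - q)) <= 0 by rewrite mulr_le0_ge0//; lra.
    by have := h e ae; lra.
  have := h m am; have := h M aM.
  have x1 : E' - q < m.
    rewrite ltNge; apply/negP => mle; have := h m am.
    by apply/negP; rewrite -leNgt mulr_le0//; lra.
  have x2 : M < E' - p.
    rewrite ltNge; apply/negP => mle; have := h M aM.
    by apply/negP; rewrite -leNgt mulr_ge0//; lra.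
  lra.
have [s Ss /andP[s1 s2]] := inc2 E SE.
exists (s + m), (s + M); split; [by apply/andP; split; lra|by lra|].
move=> E'; rewrite seg => /andP[h1 h2]; apply: contrapT => nS.
have top : p = s \/ E' - p < M.
  have := minp _ Ss; rewrite le_eqVlt => /orP[/eqP|ps]; [by left|right].
  have [h|h] := dichotomy nS Sp Ss ps.
    rewrite ltNge; apply/negP => le; have := h M aM.
    by apply/negP; rewrite -leNgt mulr_le0_ge0//; lra.
  by have := h m am; rewrite ltNge mulr_le0//; lra.
have bot : s = q \/ m < E' - q.
  have := maxq _ Ss; rewrite le_eqVlt => /orP[/eqP|sq]; [by left|right].
  have [h|h] := dichotomy nS Ss Sq sq.
    rewrite ltNge; apply/negP => le; have := h m am.
    by apply/negP; rewrite -leNgt mulr_le0_ge0//; lra.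
  by have := h M aM; rewrite ltNge mulr_ge0//; lra.
by case: top bot => [pE|?] [qE|?]; lra.
Qed.

End random_operator.

Theorem corollary1p2 (R : realType) (X : pmetricType R)
  (T : homeomorphism X) (mu : probability (borel X) R) (f : X -> R)
  (nu : probability R R) (P : probability (sequence_space nu) R)
  (Sigma1 : set R)
  (X_compact : compact [set: X])
  (mu_ergodic : ergodic mu T)
  (mu_support : measure_support (mu : set X -> \bar R) = [set: X])
  (f_continuous : continuous f)
  (nu_compact : compact (measure_support (nu : set R -> \bar R)))
  (nu_card : (`I_2 #<= measure_support (nu : set R -> \bar R))%card)
  (P_product : is_product_measure P)
  (Sigma1_spectrum : almost_sure_spectrum T mu f P Sigma1)
  (X_connected : connected [set: X]) :
  exists (n : nat) (a b : 'I_n -> R),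
    (forall i, a i < b i) /\
    Sigma1 = \bigcup_(i in [set: 'I_n]) `[a i, b i]%classic.
Proof.
have [d d_gt0 segments] := spectrum_segments X_compact mu_ergodic mu_support
  f_continuous nu_compact nu_card P_product Sigma1_spectrum X_connected.
by apply: (finite_union_of_segments _ d_gt0 segments); case: Sigma1_spectrum.
Qed.
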